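(* Let $k\ge1$ and $A\in\mathbb{C}^{k\times k}$ with $\|A-\mathbbm{1}_k\|<1/k$, let $\mathbf{w}=(w_1,\ldots,w_k)^T=A\mathbf{z}$ for $\mathbf{z}=(z_1,\ldots,z_k)^T\in\mathbb{C}^k$, and let $f:\mathbb{C}^k\to\mathbb{C}$ be holomorphic. Then \[ \frac{f(0)}{\det(A)}=\frac{1}{(2\pi i)^k}\oint_{\partial D}\cdots\oint_{\partial D}\frac{f(\mathbf{z})}{w_1\cdots w_k}\,dz_1\cdots dz_k . \]
   Context: $\|\cdot\|$ is the Frobenius norm, $\mathbbm{1}_k$ the identity, $\partial D=\{|z|=1\}$ the counterclockwise unit circle, and the integral is the iterated contour integral over the torus $(\partial D)^k$ in the variables $z_1,\ldots,z_k$. *)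

(* Defs.v *)
From Stdlib Require Import Reals Lra.
Open Scope R_scope.

Definition Cx : Type := (R * R)%type.
Definition Cre (z : Cx) : R := fst z.
Definition Cim (z : Cx) : R := snd z.
Definition RtoC (r : R) : Cx := (r, 0).
Definition C0 : Cx := (0, 0).
Definition C1 : Cx := (1, 0).
Definition Ci : Cx := (0, 1).
Definition Cadd (z w : Cx) : Cx := (fst z + fst w, snd z + snd w).
Definition Copp (z : Cx) : Cx := (- fst z, - snd z).
Definition Csub (z w : Cx) : Cx := Cadd z (Copp w).
Definition Cmul (z w : Cx) : Cx :=
  (fst z * fst w - snd z * snd w, fst z * snd w + snd z * fst w).
Definition Cinv (z : Cx) : Cx :=
  (fst z / (fst z ^ 2 + snd z ^ 2), - snd z / (fst z ^ 2 + snd z ^ 2)).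
Definition Cdiv (z w : Cx) : Cx := Cmul z (Cinv w).
Definition Cabs (z : Cx) : R := sqrt (fst z ^ 2 + snd z ^ 2).
Definition Cpow (z : Cx) (n : nat) : Cx := Nat.iter n (Cmul z) C1.
Definition Cexpi (t : R) : Cx := (cos t, sin t).

Fixpoint Csum (n : nat) (f : nat -> Cx) : Cx :=
  match n with O => C0 | S m => Cadd (Csum m f) (f m) end.
Fixpoint Cprod (n : nat) (f : nat -> Cx) : Cx :=
  match n with O => C1 | S m => Cmul (Cprod m f) (f m) end.
Fixpoint Rsum (n : nat) (f : nat -> R) : R :=
  match n with O => 0 | S m => Rsum m f + f m end.

(* A vector of Cx^k is a function nat -> Cx supported on indices < k;
   a k x k matrix is a function nat -> nat -> Cx (entries with an index >= k
   are irrelevant). *)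
Definition cvec := nat -> Cx.
Definition cmat := nat -> nat -> Cx.
Definition supported (k : nat) (z : cvec) : Prop :=
  forall j, (k <= j)%nat -> z j = C0.
Definition vzero : cvec := fun _ => C0.
Definition vadd (z h : cvec) : cvec := fun j => Cadd (z j) (h j).
Definition vnorm (k : nat) (h : cvec) : R :=
  sqrt (Rsum k (fun j => Cabs (h j) ^ 2)).

Definition mulmv (k : nat) (A : cmat) (z : cvec) : cvec :=
  fun i => Csum k (fun j => Cmul (A i j) (z j)).

Definition delta (i j : nat) : Cx := if Nat.eqb i j then C1 else C0.

Definition frob (k : nat) (A : cmat) : R :=
  sqrt (Rsum k (fun i => Rsum k (fun j => Cabs (A i j) ^ 2))).

Definition minor0 (j : nat) (A : cmat) : cmat :=
  fun r c => A (S r) (if Nat.ltb c j then c else S c).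
Fixpoint det (n : nat) (A : cmat) : Cx :=
  match n with
  | O => C1
  | S m => Csum n (fun j => Cmul (RtoC ((-1) ^ j))
                              (Cmul (A O j) (det m (minor0 j A))))
  end.

Definition holomorphic (k : nat) (f : cvec -> Cx) : Prop :=
  forall z, supported k z ->
    exists l : cvec,
      forall eps, 0 < eps -> exists delta, 0 < delta /\
        forall h, supported k h -> 0 < vnorm k h < delta ->
          Cabs (Csub (Csub (f (vadd z h)) (f z))
                     (Csum k (fun j => Cmul (l j) (h j))))
            <= eps * vnorm k h.

Definition upd (th : nat -> R) (m : nat) (t : R) : nat -> R :=
  fun j => if Nat.eqb j m then t else th j.

(* iter_int n g v : the iterated Riemann integral
     int_0^{2pi} ( ... ( int_0^{2pi} g(th) dth_0 ) ... ) dth_{n-1}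
   exists (each intermediate integral existing) and equals v.
   The innermost integration is in th_0, the outermost in th_{n-1}. *)
Fixpoint iter_int (n : nat) (g : (nat -> R) -> R) (v : R) : Prop :=
  match n with
  | O => v = g (fun _ => 0)
  | S m => exists h : R -> R,
      (forall t, iter_int m (fun th => g (upd th m t)) (h t)) /\
      exists pr : Riemann_integrable h 0 (2 * PI), RiemannInt pr = v
  end.

Definition torus_pt (k : nat) (th : nat -> R) : cvec :=
  fun j => if Nat.ltb j k then Cexpi (th j) else C0.

(* The contour integral  oint...oint_{dD} F(z) dz_1 ... dz_k  equals v:
   with z_j = e^{i th_j}, dz_j = i e^{i th_j} dth_j, the real and imaginary
   parts of the iterated integral over [0,2pi]^k exist and give v. *)
Definition torus_integral (k : nat) (F : cvec -> Cx) (v : Cx) : Prop :=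
  let G := fun th =>
    Cmul (F (torus_pt k th)) (Cprod k (fun j => Cmul Ci (Cexpi (th j)))) in
  iter_int k (fun th => Cre (G th)) (Cre v) /\
  iter_int k (fun th => Cim (G th)) (Cim v).

(* Main.v *)
(** Strict row diagonal dominance of [A], which follows from [|A - 1| < 1/k],
    makes every [w_i] nonvanishing when [|z_i| = 1] and the other [|z_j| <= 1].
    Hence, as a function of [z_1], the integrand has one simple pole in the closed
    disc, the zero [c] of [w_1], which is linear in the other variables, and
    Cauchy's formula removes [z_1]: [f] becomes [f(c(z'), z')], [A] becomes its
    Schur complement [A'], again diagonally dominant, and a factor [1/a_11]
    appears, with [det A = a_11 det A'].  Induct on [k].

    As [holomorphic] does not include continuity of the derivative, Cauchy's
    formula rests on Goursat's bisection argument, applied to the homotopy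
    [c + s (e^(it) - c)] that shrinks the unit circle to [c]. *)

From Pilot Require Import Defs.
From Stdlib Require Import Reals Lra Lia Classical FunctionalExtensionality.
From mathcomp Require all_boot all_algebra complex Rstruct.
From Coquelicot Require Import Coquelicot.
Open Scope R_scope.

(** * Determinants and Schur complements *)

(** In [iter_int] the angle [th_0] is innermost, so the eliminated variable is the one integrated
    first. Orders of integration are never exchanged, and the closed form of the inner integral also
    supplies the existence demanded at each level. The induction needs a class of functions stable
    under the substitution of [c(z')] for the first variable; holomorphy along complex lines is such
    a class because [c] is linear. Bisection acts on rectangles, and the homotopy provides one:
    [0 <= s <= 1], [0 <= t <= 2 PI]. The Cauchy kernel pulls back to a form whose [dt] coefficient
    is free of [s], so that it makes sense at [s = 0] too, and the limit there follows from
    continuity at [c]. This replaces [F] by its value at [c], and what remains is the integral of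
    the kernel itself. It is found without logarithms or winding numbers: for [c = 0] the kernel is
    1, which yields the mean value property, and this property evaluates the kernel for every other
    [c]. *)

Lemma RtoC_sign_S j :
  RtoC ((-1) ^ S j) = Cmul (Copp Defs.C1) (RtoC ((-1) ^ j)).
Proof. unfold RtoC, Cmul, Copp, Defs.C1; simpl; f_equal; ring. Qed.

Lemma Cmul_Cinv_l z : z <> C0 -> Cmul (Cinv z) z = Defs.C1.
Proof. exact (Coquelicot.Complex.Cinv_l z). Qed.

Module DetSchur.
Import all_boot all_algebra complex Rstruct.
Import GRing.Theory.
Local Open Scope ring_scope.

(** Passage to a field with a developed determinant theory: multiplicativity and block triangular
    determinants become available for the recursion [det]. *)
Definition toC (z : Cx) : R[i] := (fst z +i* snd z)%C.

Lemma toC_inj z w : toC z = toC w -> z = w.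
Proof. by case: z w => [a b] [c d] [-> ->]. Qed.

Lemma toC_add z w : toC (Cadd z w) = toC z + toC w.
Proof. by []. Qed.

Lemma toC_opp z : toC (Copp z) = - toC z.
Proof. by []. Qed.

Lemma toC_mul z w : toC (Cmul z w) = toC z * toC w.
Proof. by []. Qed.

Lemma toC_sum (n : nat) (f : nat -> Cx) : toC (Csum n f) = \sum_(i < n) toC (f i).
Proof.
elim: n => [|n IHn]; first by rewrite big_ord0.
by rewrite big_ord_recr /= toC_add IHn.
Qed.

(* [IZR (Zneg xH)] is the [-1] in [det]; the literal would be read in [ring_scope]. *)
Lemma toC_sign (j : nat) : toC (RtoC (pow (IZR (Zneg xH)) j)) = (-1) ^+ j.
Proof.
elim: j => [|j IHj] //.
by rewrite RtoC_sign_S toC_mul IHj exprS.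
Qed.

(** Both sides expand along row 0; [minor0] skips column [j] just as [bump] does in the cofactor. *)
Lemma toC_det (n : nat) A : toC (det n A) = \det (\matrix_(i < n, j < n) toC (A i j)).
Proof.
elim: n A => [|n IHn] A; first by rewrite det_mx00.
rewrite -[det n.+1 A]/(Csum n.+1 _) toC_sum (expand_det_row _ ord0).
apply: eq_bigr => j _; rewrite !toC_mul toC_sign IHn mxE mulrCA /cofactor add0n.
congr (_ * (_ * \det _)); apply/matrixP => r c; rewrite !mxE /minor0 /=.
congr (toC (A _ _)); rewrite /bump /=.
case: (Nat.ltb_spec c j) => [/ltP cj|/leP jc]; first by rewrite leqNgt cj.
by rewrite jc.
Qed.

(** One step of Gaussian elimination: the unit lower triangular [L] has determinant 1 and clears the
    first column below the pivot, and [L *m M] is block upper triangular with the Schur complement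
    as its lower block. *)
Lemma det_schur (n : nat) (A : cmat) : A O O <> C0 ->
  det n.+1 A = Cmul (A O O) (det n (fun i j =>
    Csub (A i.+1 j.+1) (Cmul (Cmul (A i.+1 O) (Cinv (A O O))) (A O j.+1)))).
Proof.
move=> nz; apply: toC_inj; rewrite toC_mul !toC_det.
have inv1 : toC (Cinv (A O O)) * toC (A O O) = 1.
  by rewrite -toC_mul Cmul_Cinv_l.
pose M : 'M[R[i]]_(1 + n) := \matrix_(i, j) toC (A i j).
pose L : 'M[R[i]]_(1 + n) := block_mx 1%:M 0
  (\col_i (- (toC (A i.+1 O) * toC (Cinv (A O O))))) 1%:M.
have <- : \det (L *m M) = \det M.
  by rewrite det_mulmx det_lblock !det1 !mul1r.
rewrite -[M]submxK mulmx_block !mul1mx !mul0mx !addr0.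
set X := _ *m ulsubmx M + _.
have -> : X = 0.
  apply/matrixP => i j; rewrite !mxE big_ord1 !mxE !ord1 /= mulNr -mulrA.
  by rewrite inv1 mulr1 /rshift /=; apply/eqP; rewrite addNr.
rewrite det_ublock.
have -> : \det (ulsubmx M) = toC (A O O) by rewrite det_mx11 !mxE.
congr (_ * _); congr determinant.
apply/matrixP => i j; rewrite !mxE big_ord1 !mxE /= toC_add toC_opp !toC_mul.
by rewrite mulNr addrC.
Qed.
End DetSchur.

(** * Goursat's theorem for closed forms on a rectangle *)

(** [J n x y] stands for a boundary integral over the rectangle with lower left corner [(x, y)] and
    sides [w / 2 ^ n], [e / 2 ^ n], which is cut into four quarters. *)
Definition quad_additive (w e : R) (J : nat -> R -> R -> R) (a b c d : R) : Prop :=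
  forall n x y, a <= x -> x + w / 2 ^ n <= b -> c <= y -> y + e / 2 ^ n <= d ->
  J n x y = J (S n) x y + J (S n) (x + w / 2 ^ S n) y
          + J (S n) x (y + e / 2 ^ S n) + J (S n) (x + w / 2 ^ S n) (y + e / 2 ^ S n).

(** Some quarter always carries at least a quarter of the absolute value. Iterating this choice
    nests the rectangles; their lower left corners increase, and the suprema of the coordinates give
    a common point. *)
Lemma quad_bisection (w e x0 y0 : R) (J : nat -> R -> R -> R) :
  0 <= w -> 0 <= e ->
  quad_additive w e J x0 (x0 + w) y0 (y0 + e) ->
  exists x y, x0 <= x <= x0 + w /\ y0 <= y <= y0 + e /\
    forall n, exists p q,
      x0 <= p /\ p + w / 2 ^ n <= x0 + w /\ y0 <= q /\ q + e / 2 ^ n <= y0 + e /\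
      p <= x <= p + w / 2 ^ n /\ q <= y <= q + e / 2 ^ n /\
      Rabs (J O x0 y0) / 4 ^ n <= Rabs (J n p q).
Proof.
intros Hw He HJ.
set (t := fun n (p : R * R) => Rabs (J n (fst p) (snd p))).
(* The last quarter is taken untested: when the other three are too small, the triangle inequality
   forces it to be large enough. *)
set (step := fun n (p : R * R) =>
  let p1 := (fst p, snd p) in
  let p2 := (fst p + w / 2 ^ S n, snd p) in
  let p3 := (fst p, snd p + e / 2 ^ S n) in
  let p4 := (fst p + w / 2 ^ S n, snd p + e / 2 ^ S n) in
  if Rle_dec (t n p / 4) (t (S n) p1) then p1 else
  if Rle_dec (t n p / 4) (t (S n) p2) then p2 else
  if Rle_dec (t n p / 4) (t (S n) p3) then p3 else p4).
set (P := fix P n := match n with O => (x0, y0) | S m => step m (P m) end).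
assert (Hhalf : forall (u : R) n, u / 2 ^ n = u / 2 ^ S n + u / 2 ^ S n).
{ intros u n. simpl. field. apply pow_nonzero; lra. }
assert (Hpos : forall (u : R) n, 0 <= u -> 0 <= u / 2 ^ n).
{ intros u n Hu. apply Rmult_le_pos; [easy|].
  left; apply Rinv_0_lt_compat, pow_lt; lra. }
assert (Hstep : forall n p, 
  fst p <= fst (step n p) /\ fst (step n p) + w / 2 ^ S n <= fst p + w / 2 ^ n /\
  snd p <= snd (step n p) /\ snd (step n p) + e / 2 ^ S n <= snd p + e / 2 ^ n).
{ intros n p. rewrite (Hhalf w n), (Hhalf e n).
  pose proof (Hpos w (S n) Hw). pose proof (Hpos e (S n) He).
  unfold step.
  destruct Rle_dec; [|destruct Rle_dec; [|destruct Rle_dec]]; cbn [fst snd]; lra. }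
assert (Hin : forall n, x0 <= fst (P n) /\ fst (P n) + w / 2 ^ n <= x0 + w /\
   y0 <= snd (P n) /\ snd (P n) + e / 2 ^ n <= y0 + e).
{ induction n as [|n IH]; [unfold P; simpl; lra|].
  change (P (S n)) with (step n (P n)).
  specialize (Hstep n (P n)). lra. }
assert (Ht : forall n, Rabs (J O x0 y0) / 4 ^ n <= t n (P n)).
{ induction n as [|n IH]; [unfold t, P; simpl; lra|].
  change (P (S n)) with (step n (P n)).
  apply Rle_trans with (t n (P n) / 4).
  { replace (Rabs (J O x0 y0) / 4 ^ S n) with (Rabs (J O x0 y0) / 4 ^ n / 4); [lra|].
    simpl; field. apply pow_nonzero; lra. }
  unfold step.
  destruct Rle_dec as [|H1]; [easy|destruct Rle_dec as [|H2]; [easy|destruct Rle_dec as [|H3]; [easy|]]].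
  destruct (Hin n) as (A1 & A2 & A3 & A4).
  pose proof (HJ n (fst (P n)) (snd (P n)) A1 A2 A3 A4) as E.
  unfold t in *; cbn [fst snd] in *.
  rewrite E in H1, H2, H3 |- *.
  match type of E with _ = ?u1 + ?u2 + ?u3 + ?u4 =>
    set (j1 := u1) in *; set (j2 := u2) in *; set (j3 := u3) in *; set (j4 := u4) in * end.
  pose proof (Rabs_triang (j1 + j2 + j3) j4).
  pose proof (Rabs_triang (j1 + j2) j3).
  pose proof (Rabs_triang j1 j2). lra. }
assert (Hmono : forall n m, fst (P n) <= fst (P (n + m)%nat) /\
   fst (P (n + m)%nat) + w / 2 ^ (n + m) <= fst (P n) + w / 2 ^ n /\
   snd (P n) <= snd (P (n + m)%nat) /\
   snd (P (n + m)%nat) + e / 2 ^ (n + m) <= snd (P n) + e / 2 ^ n).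
{ intros n m. induction m as [|m IH]; [rewrite Nat.add_0_r; lra|].
  rewrite Nat.add_succ_r.
  change (P (S (n + m))) with (step (n + m)%nat (P (n + m)%nat)).
  specialize (Hstep (n + m)%nat (P (n + m)%nat)). lra. }
(* Each right edge bounds all left edges, earlier and later, so the supremum of the left edges lies
   in every interval. *)
assert (Hx : forall n m, fst (P m) <= fst (P n) + w / 2 ^ n).
{ intros n m. destruct (Nat.le_ge_cases n m) as [H|H].
  - pose proof (Hmono n (m - n)%nat) as G. replace (n + (m - n))%nat with m in G by lia.
    pose proof (Hpos w m Hw). lra.
  - pose proof (Hmono m (n - m)%nat) as G. replace (m + (n - m))%nat with n in G by lia.
    pose proof (Hpos w n Hw). lra. }
assert (Hy : forall n m, snd (P m) <= snd (P n) + e / 2 ^ n).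
{ intros n m. destruct (Nat.le_ge_cases n m) as [H|H].
  - pose proof (Hmono n (m - n)%nat) as G. replace (n + (m - n))%nat with m in G by lia.
    pose proof (Hpos e m He). lra.
  - pose proof (Hmono m (n - m)%nat) as G. replace (m + (n - m))%nat with n in G by lia.
    pose proof (Hpos e n He). lra. }
destruct (completeness (fun r => exists n, r = fst (P n))) as [x [Hx1 Hx2]].
{ exists (fst (P O) + w / 2 ^ 0). intros r [m ->]. apply Hx. }
{ exists (fst (P O)), O. reflexivity. }
destruct (completeness (fun r => exists n, r = snd (P n))) as [y [Hy1 Hy2]].
{ exists (snd (P O) + e / 2 ^ 0). intros r [m ->]. apply Hy. }
{ exists (snd (P O)), O. reflexivity. }
assert (Bx : forall n, fst (P n) <= x <= fst (P n) + w / 2 ^ n).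
{ intros n. split; [apply Hx1; eauto|]. apply Hx2. intros r [m ->]. apply Hx. }
assert (By : forall n, snd (P n) <= y <= snd (P n) + e / 2 ^ n).
{ intros n. split; [apply Hy1; eauto|]. apply Hy2. intros r [m ->]. apply Hy. }
exists x, y. split; [|split].
- specialize (Bx O). simpl in Bx. lra.
- specialize (By O). simpl in By. lra.
- intros n. exists (fst (P n)), (snd (P n)).
  destruct (Hin n) as (A1 & A2 & A3 & A4). repeat split; try easy; try apply Bx; try apply By.

Qed.

Lemma differentiable_continuous_x (f : R -> R -> R) x y lx ly :
  differentiable_pt_lim f x y lx ly -> continuous (fun u => f u y) x.
Proof.
intros H.
assert (C : continuity_2d_pt f x y) by (apply differentiable_continuity_pt; exists lx, ly; exact H).
apply continuity_pt_filterlim, continuity_pt_locally. intros eps.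
destruct (C eps) as [del Hd]. exists del. intros u Hu. apply Hd; [exact Hu|].
rewrite Rminus_eq_0, Rabs_R0. apply cond_pos.
Qed.

Lemma differentiable_pt_lim_swap (f : R -> R -> R) x y lx ly :
  differentiable_pt_lim f x y lx ly ->
  differentiable_pt_lim (fun u v => f v u) y x ly lx.
Proof.
intros H eps. destruct (H eps) as [d Hd]. exists d. intros u v Hu Hv.
rewrite Rmax_comm, (Rplus_comm (ly * _)). now apply Hd.
Qed.

Lemma differentiable_continuous_y (f : R -> R -> R) x y lx ly :
  differentiable_pt_lim f x y lx ly -> continuous (fun v => f x v) y.
Proof.
intros H. apply (differentiable_continuous_x (fun u v => f v u) y x ly lx).
now apply differentiable_pt_lim_swap.
Qed.

Lemma pow_half_small (w del : R) : 0 <= w -> 0 < del -> exists n, w / 2 ^ n < del.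
Proof.
intros Hw Hd.
destruct (pow_lt_1_zero (/ 2) (ltac:(rewrite Rabs_pos_eq; lra)) (del / (w + 1))) as [n Hn].
{ apply Rdiv_lt_0_compat; lra. }
exists n. specialize (Hn n (Nat.le_refl n)).
rewrite pow_inv, Rabs_pos_eq in Hn by (left; apply Rinv_0_lt_compat, pow_lt; lra).
assert (0 < / 2 ^ n) by (apply Rinv_0_lt_compat, pow_lt; lra).
apply (Rmult_lt_compat_l (w + 1)) in Hn; [|lra].
replace ((w + 1) * (del / (w + 1))) with del in Hn by (field; lra).
unfold Rdiv. nra.
Qed.

(** Serves for a pair of opposite sides of a small rectangle, along which the difference of the
    integrands is nearly constant. *)
Lemma RInt_near_const (f : R -> R) a b k M :
  a <= b -> (forall x, a <= x <= b -> continuous f x) ->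
  (forall x, a <= x <= b -> Rabs (f x - k) <= M) ->
  Rabs (RInt f a b - k * (b - a)) <= (b - a) * M.
Proof.
intros ab Hc Hb.
assert (E : ex_RInt f a b).
{ apply (ex_RInt_continuous (V := R_CompleteNormedModule)). intros z.
  rewrite Rmin_left, Rmax_right by easy. apply Hc. }
replace (RInt f a b - k * (b - a)) with (RInt (fun x => f x - k) a b).
{ apply abs_RInt_le_const; [easy| |easy].
  apply (ex_RInt_minus (V := R_NormedModule) f (fun _ => k)); [easy|apply ex_RInt_const]. }
transitivity (minus (RInt f a b) (RInt (fun _ => k) a b)).
{ exact (RInt_minus (V := R_CompleteNormedModule) f (fun _ => k) a b E (ex_RInt_const a b k)). }
rewrite RInt_const. unfold minus, plus, opp, scal; simpl. unfold mult; simpl. ring.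
Qed.

(* The common [m] says that [P dx + Q dy] is closed; the partial derivatives need
   not be continuous. *)
Lemma green_goursat (P Q : R -> R -> R) (x0 y0 w e : R) :
  0 <= w -> 0 <= e ->
  (forall x y, x0 <= x <= x0 + w -> y0 <= y <= y0 + e -> exists p m q,
     differentiable_pt_lim P x y p m /\ differentiable_pt_lim Q x y m q) ->
  RInt (fun x => P x y0 - P x (y0 + e)) x0 (x0 + w)
  + RInt (fun y => Q (x0 + w) y - Q x0 y) y0 (y0 + e) = 0.
Proof.
intros Hw He HD.
assert (CP : forall x y, x0 <= x <= x0 + w -> y0 <= y <= y0 + e ->
   continuous (fun u => P u y) x).
{ intros x y Hx Hy. destruct (HD x y Hx Hy) as (p & m & q & H1 & H2).
  eapply differentiable_continuous_x; exact H1. }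
assert (CQ : forall x y, x0 <= x <= x0 + w -> y0 <= y <= y0 + e ->
   continuous (fun v => Q x v) y).
{ intros x y Hx Hy. destruct (HD x y Hx Hy) as (p & m & q & H1 & H2).
  eapply differentiable_continuous_y; exact H2. }
assert (EP : forall y a b, y0 <= y <= y0 + e -> x0 <= a <= b -> b <= x0 + w ->
  ex_RInt (fun x => P x y) a b).
{ intros y a b Hy Ha Hb. apply (ex_RInt_continuous (V := R_CompleteNormedModule)).
  intros z. rewrite Rmin_left, Rmax_right by lra. intros. apply CP; lra. }
assert (EQ : forall x a b, x0 <= x <= x0 + w -> y0 <= a <= b -> b <= y0 + e ->
  ex_RInt (fun y => Q x y) a b).
{ intros x a b Hx Ha Hb. apply (ex_RInt_continuous (V := R_CompleteNormedModule)).
  intros z. rewrite Rmin_left, Rmax_right by lra. intros. apply CQ; lra. }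
(* The integral of [P dx + Q dy] counterclockwise around a rectangle of level [n]; inner sides of a
   subdivision cancel. *)
set (J := fun n x y =>
  RInt (fun s => P s y - P s (y + e / 2 ^ n)) x (x + w / 2 ^ n)
  + RInt (fun t => Q (x + w / 2 ^ n) t - Q x t) y (y + e / 2 ^ n)).
assert (Hpos : forall (u : R) n, 0 <= u -> 0 <= u / 2 ^ n).
{ intros u n Hu. apply Rmult_le_pos; [easy|].
  left; apply Rinv_0_lt_compat, pow_lt; lra. }
assert (Jsplit : forall n x y, x0 <= x -> x + w / 2 ^ n <= x0 + w -> y0 <= y ->
  y + e / 2 ^ n <= y0 + e -> J n x y =
  RInt (fun s => P s y) x (x + w / 2 ^ n) - RInt (fun s => P s (y + e / 2 ^ n)) x (x + w / 2 ^ n)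
  + (RInt (fun t => Q (x + w / 2 ^ n) t) y (y + e / 2 ^ n) - RInt (fun t => Q x t) y (y + e / 2 ^ n))).
{ intros n x y A1 A2 A3 A4. pose proof (Hpos w n Hw). pose proof (Hpos e n He).
  unfold J. f_equal.
  - apply (RInt_minus (V := R_CompleteNormedModule) (fun s => P s y)); apply EP; lra.
  - apply (RInt_minus (V := R_CompleteNormedModule) (fun t => Q (x + w / 2 ^ n) t)); apply EQ; lra. }
assert (Hadd : quad_additive w e J x0 (x0 + w) y0 (y0 + e)).
{ intros n x y A1 A2 A3 A4.
  pose proof (Hpos w (S n) Hw). pose proof (Hpos e (S n) He).
  assert (Ew : w / 2 ^ n = w / 2 ^ S n + w / 2 ^ S n) by (simpl; field; apply pow_nonzero; lra).
  assert (Ee : e / 2 ^ n = e / 2 ^ S n + e / 2 ^ S n) by (simpl; field; apply pow_nonzero; lra).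
  rewrite Jsplit by lra. rewrite 4!Jsplit by lra.
  rewrite Ew, Ee in *. set (p := w / 2 ^ S n) in *. set (q := e / 2 ^ S n) in *.
  rewrite <- !Rplus_assoc in *.
  assert (SP : forall v, y0 <= v <= y0 + e ->
    RInt (fun s => P s v) x (x + p + p) =
    RInt (fun s => P s v) x (x + p) + RInt (fun s => P s v) (x + p) (x + p + p)).
  { intros v Hv. symmetry.
    apply (RInt_Chasles (V := R_CompleteNormedModule) (fun s => P s v)); apply EP; lra. }
  assert (SQ : forall u, x0 <= u <= x0 + w ->
    RInt (fun t => Q u t) y (y + q + q) =
    RInt (fun t => Q u t) y (y + q) + RInt (fun t => Q u t) (y + q) (y + q + q)).
  { intros v Hv. symmetry.
    apply (RInt_Chasles (V := R_CompleteNormedModule) (fun s => Q v s)); apply EQ; lra. }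
  rewrite !SP, !SQ by lra. ring. }
replace (_ + _) with (J O x0 y0) by (unfold J; simpl; rewrite !Rdiv_1_r; reflexivity).
destruct (quad_bisection w e x0 y0 J Hw He Hadd) as (x & y & Hx & Hy & Hn).
destruct (HD x y Hx Hy) as (p1 & m & q2 & DP & DQ).
apply NNPP; intros Hne. apply Rabs_pos_lt in Hne.
set (eta := Rabs (J O x0 y0)) in *.
(* With sides [p], [q] at level [n], linearization costs [eps * (p + q)] at each point, hence
   [2 * eps * (p + q) ^ 2 = eps * K / 4 ^ n] around the boundary. The choice [eps = eta / (K + 1)]
   puts this strictly below the [eta / 4 ^ n] kept by the bisection. *)
set (K := 2 * (w + e) * (w + e)).
assert (HK : 0 <= K) by (unfold K; nra).
assert (Heps : 0 < eta / (K + 1)) by (apply Rdiv_lt_0_compat; lra).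
set (eps := mkposreal _ Heps).
destruct (DP eps) as [d1 H1]. destruct (DQ eps) as [d2 H2].
destruct (pow_half_small (w + e) (Rmin d1 d2)) as [n Hsmall].
{ lra. } { apply Rmin_pos; apply cond_pos. }
assert (Hs1 : (w + e) / 2 ^ n < d1) by (eapply Rlt_le_trans; [exact Hsmall|apply Rmin_l]).
assert (Hs2 : (w + e) / 2 ^ n < d2) by (eapply Rlt_le_trans; [exact Hsmall|apply Rmin_r]).
destruct (Hn n) as (a & b & A1 & A2 & A3 & A4 & A5 & A6 & A7).
pose proof (Hpos w n Hw) as Pp. pose proof (Hpos e n He) as Pq.
replace ((w + e) / 2 ^ n) with (w / 2 ^ n + e / 2 ^ n) in * by (field; apply pow_nonzero; lra).
unfold J in A7.
assert (E4 : 4 ^ n = 2 ^ n * 2 ^ n) by (rewrite <- Rpow_mult_distr; f_equal; lra).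
assert (EK : 2 * (w / 2 ^ n + e / 2 ^ n) * (w / 2 ^ n + e / 2 ^ n) = K / 4 ^ n).
{ rewrite E4. unfold K. field. apply pow_nonzero; lra. }
assert (P4 : 0 < 4 ^ n) by (apply pow_lt; lra).
set (p := w / 2 ^ n) in *. set (q := e / 2 ^ n) in *.
assert (B : forall (F : R -> R -> R) l1 l2 u v, a <= u <= a + p -> b <= v <= b + q ->
  Rabs (F u v - F x y - (l1 * (u - x) + l2 * (v - y))) <= eps * Rmax (Rabs (u - x)) (Rabs (v - y)) ->
  Rabs (F u v - F x y - (l1 * (u - x) + l2 * (v - y))) <= eps * (p + q)).
{ intros F l1 l2 u v Hu Hv G. eapply Rle_trans; [exact G|].
  apply Rmult_le_compat_l; [left; apply cond_pos|].
  apply Rmax_lub; apply Rabs_le; lra. }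
assert (BP : forall u v, a <= u <= a + p -> b <= v <= b + q ->
  Rabs (P u v - P x y - (p1 * (u - x) + m * (v - y))) <= eps * (p + q)).
{ intros u v Hu Hv. apply B; try easy. apply H1; apply Rabs_def1; lra. }
assert (BQ : forall u v, a <= u <= a + p -> b <= v <= b + q ->
  Rabs (Q u v - Q x y - (m * (u - x) + q2 * (v - y))) <= eps * (p + q)).
{ intros u v Hu Hv. apply B; try easy. apply H2; apply Rabs_def1; lra. }
(* Closedness enters here: the main terms [- m * q] over length [p] and [m * p] over length [q]
   cancel. *)
assert (I1 := RInt_near_const (fun s => P s b - P s (b + q)) a (a + p) (- m * q) (2 * (eps * (p + q)))).
assert (I2 := RInt_near_const (fun t => Q (a + p) t - Q a t) b (b + q) (m * p) (2 * (eps * (p + q)))).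
lapply I1; [clear I1; intros I1|lra].
lapply I1; [clear I1; intros I1|].
2: { intros u Hu. apply (continuous_minus (V := R_NormedModule) (fun s => P s b)); apply CP; lra. }
lapply I1; [clear I1; intros I1|].
2: { intros u Hu. pose proof (BP u b Hu ltac:(lra)) as G1. pose proof (BP u (b + q) Hu ltac:(lra)) as G2.
  apply Rabs_le_between in G1. apply Rabs_le_between in G2. apply Rabs_le. nra. }
lapply I2; [clear I2; intros I2|lra].
lapply I2; [clear I2; intros I2|].
2: { intros u Hu. apply (continuous_minus (V := R_NormedModule) (fun s => Q (a + p) s)); apply CQ; lra. }
lapply I2; [clear I2; intros I2|].
2: { intros u Hu. pose proof (BQ a u ltac:(lra) Hu) as G1. pose proof (BQ (a + p) u ltac:(lra) Hu) as G2.
  apply Rabs_le_between in G1. apply Rabs_le_between in G2. apply Rabs_le. nra. }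
set (j1 := RInt _ a (a + p)) in *. set (j2 := RInt _ b (b + q)) in *.
assert (G : Rabs (j1 + j2) <= eps * (K / 4 ^ n)).
{ rewrite <- EK. apply Rabs_le_between in I1. apply Rabs_le_between in I2. apply Rabs_le. nra. }
assert (G2 : eps * (K / 4 ^ n) < eta / 4 ^ n).
{ replace (eps * (K / 4 ^ n)) with (K / (K + 1) * (eta / 4 ^ n)).
  2: { unfold eps; simpl. field. split; lra. }
  assert (0 < eta / 4 ^ n) by (apply Rdiv_lt_0_compat; lra).
  assert (K / (K + 1) < 1) by (apply Rlt_div_l; lra).
  nra. }
lra.
Qed.

(** * Cauchy's formula in the unit disc *)

Lemma differentiable_pt_lim_mult (f g : R -> R -> R) x y fx fy gx gy :
  differentiable_pt_lim f x y fx fy -> differentiable_pt_lim g x y gx gy ->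
  differentiable_pt_lim (fun u v => f u v * g u v) x y
    (g x y * fx + f x y * gx) (g x y * fy + f x y * gy).
Proof.
intros Hf Hg.
apply (differentiable_pt_lim_comp (fun a b => a * b)); [|easy|easy].
intros eps. exists eps. intros u v Hu Hv.
replace (_ - _ - _) with ((u - f x y) * (v - g x y)) by ring.
rewrite Rabs_mult. apply Rmult_le_compat; try apply Rabs_pos; [lra|apply Rmax_r].
Qed.

Lemma differentiable_pt_lim_plus (f g : R -> R -> R) x y fx fy gx gy :
  differentiable_pt_lim f x y fx fy -> differentiable_pt_lim g x y gx gy ->
  differentiable_pt_lim (fun u v => f u v + g u v) x y (fx + gx) (fy + gy).
Proof.
intros Hf Hg.
replace (fx + gx) with (1 * fx + 1 * gx) by ring.
replace (fy + gy) with (1 * fy + 1 * gy) by ring.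
apply (differentiable_pt_lim_comp (fun a b => a + b)); [|easy|easy].
intros eps. exists (mkposreal 1 Rlt_0_1). intros u v Hu Hv.
replace (_ - _ - _) with 0 by ring. rewrite Rabs_R0.
apply Rmult_le_pos; [left; apply cond_pos|]. eapply Rle_trans; [|apply Rmax_l]. apply Rabs_pos.
Qed.

Lemma differentiable_pt_lim_fst (f : R -> R) x y l :
  is_derive f x l -> differentiable_pt_lim (fun u _ => f u) x y l 0.
Proof. intros H. apply differentiable_pt_lim_proj1_0. now apply is_derive_Reals. Qed.

Lemma differentiable_pt_lim_snd (f : R -> R) x y l :
  is_derive f y l -> differentiable_pt_lim (fun _ v => f v) x y 0 l.
Proof.
intros H. apply (differentiable_pt_lim_swap (fun u _ => f u)).
now apply differentiable_pt_lim_fst.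
Qed.

Notation C_is_derive := (@is_derive C_AbsRing (AbsRing_NormedModule C_AbsRing)).
Notation C_ex_derive := (@ex_derive C_AbsRing (AbsRing_NormedModule C_AbsRing)).

Lemma C_is_derive_iff (F : C -> C) (z l : C) :
  C_is_derive F z l <->
  forall eps : posreal, exists del : posreal, forall w : C, Cmod (w - z) < del ->
    Cmod (F w - F z - l * (w - z)) <= eps * Cmod (w - z).
Proof.
split.
- intros [_ H] eps. specialize (H z (fun P HP => HP) eps). destruct H as [d Hd].
  exists d. intros w Hw. specialize (Hd w Hw).
  rewrite (Cmult_comm l). exact Hd.
- intros H. split; [apply is_linear_scal_l|].
  intros z' Hz'. rewrite <- (is_filter_lim_locally_unique _ _ Hz').
  intros eps. destruct (H eps) as [d Hd]. exists d. intros w Hw.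
  specialize (Hd w Hw). rewrite (Cmult_comm l) in Hd. exact Hd.
Qed.

Lemma Cmod_le_2Rmax (z : C) : Cmod z <= 2 * Rmax (Rabs (fst z)) (Rabs (snd z)).
Proof.
eapply Rle_trans; [apply Cmod_2Rmax|].
apply Rmult_le_compat_r.
{ eapply Rle_trans; [apply Rabs_pos|apply Rmax_l]. }
pose proof (sqrt_sqrt 2 ltac:(lra)). pose proof (sqrt_pos 2). nra.
Qed.

Lemma im_le_Cmod (z : C) : Rabs (snd z) <= Cmod z.
Proof. eapply Rle_trans; [apply Rmax_r|apply Rmax_Cmod]. Qed.

Lemma cauchy_riemann (F : C -> C) (x y a b : R) :
  C_is_derive F (x, y) (a, b) ->
  differentiable_pt_lim (fun u v => fst (F (u, v))) x y a (- b) /\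
  differentiable_pt_lim (fun u v => snd (F (u, v))) x y b a.
Proof.
intros H. rewrite C_is_derive_iff in H.
(* [Cmod] is at most twice the maximum norm; halving both [eps] and the radius absorbs this
   factor. *)
assert (G : forall eps : posreal, exists del : posreal, forall u v,
   Rabs (u - x) < del -> Rabs (v - y) < del ->
   Cmod (F (u, v) - F (x, y) - (a, b) * ((u, v) - (x, y)))
     <= eps * Rmax (Rabs (u - x)) (Rabs (v - y))).
{ intros eps. destruct (H (pos_div_2 eps)) as [d Hd]. exists (pos_div_2 d).
  intros u v Hu Hv. simpl in Hu, Hv.
  pose proof (Cmod_le_2Rmax (((u, v) : C) - (x, y))%C) as M.
  change (_ <= _) with (Cmod (((u, v) : C) - (x, y)) <= 2 * Rmax (Rabs (u - x)) (Rabs (v - y))) in M.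
  assert (Rmax (Rabs (u - x)) (Rabs (v - y)) < d / 2) by (apply Rmax_lub_lt; easy).
  specialize (Hd (u, v)). change (pos (pos_div_2 eps)) with (eps / 2) in Hd. eapply Rle_trans; [apply Hd; lra|].
  replace (eps * _) with (eps / 2 * (2 * Rmax (Rabs (u - x)) (Rabs (v - y)))) by field.
  apply Rmult_le_compat_l; [|exact M]. pose proof (cond_pos eps); lra. }
split; intros eps; destruct (G eps) as [d Hd]; exists d; intros u v Hu Hv;
  (eapply Rle_trans; [|exact (Hd u v Hu Hv)]).
- eapply Rle_trans; [|apply re_le_Cmod]. right. unfold Re. simpl. f_equal. ring.
- eapply Rle_trans; [|apply im_le_Cmod]. right. simpl. f_equal. ring.
Qed.

Definition Cis (t : R) : C := (cos t, sin t).

Lemma Cmod_Cis t : Cmod (Cis t) = 1.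
Proof.
unfold Cmod, Cis; simpl. replace (_ + _) with 1; [apply sqrt_1|].
pose proof (sin2_cos2 t) as H. unfold Rsqr in H. lra.
Qed.

Lemma Cmod_sub_lower (z w : C) : Cmod z - Cmod w <= Cmod (z - w).
Proof.
pose proof (Cmod_triangle (z - w) w) as H.
replace (z - w + w)%C with z in H by ring. lra.
Qed.

(** * Shrinking the unit circle to the pole *)

Section Homotopy.
Variables (F : C -> C) (c : C).
Hypothesis Hc : Cmod c < 1.
Hypothesis HF : forall z, Cmod z <= 1 -> C_ex_derive F z.

(* [G s] runs through the circle of centre [(1 - s) c] and radius [s].  As
   [G s t - c = s (e^(it) - c)], the form [-i F(z) dz / (z - c)] pulls back to
   [F(G) (-i ds / s + kap dt)], whose real part is [P ds + Q dt] below. *)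
Let G (s t : R) : C := (c + RtoC s * (Cis t - c))%C.
Let kap (t : R) : C := (Cis t / (Cis t - c))%C.

Lemma Cis_sub_neq t : (Cis t - c)%C <> 0.
Proof.
apply Cmod_gt_0. pose proof (Cmod_sub_lower (Cis t) c). rewrite Cmod_Cis in H. lra.
Qed.

Lemma Cis_sub_sqr_pos t : 0 < (cos t - fst c) ^ 2 + (sin t - snd c) ^ 2.
Proof.
pose proof (proj1 (Cmod_gt_0 _) (Cis_sub_neq t)) as H.
unfold Cmod in H. rewrite <- sqrt_0 in H at 1. exact (sqrt_lt_0_alt _ _ H).
Qed.

Lemma G_in_disc s t : 0 <= s <= 1 -> Cmod (G s t) <= 1.
Proof.
intros Hs. replace (G s t) with (RtoC (1 - s) * c + RtoC s * Cis t)%C.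
2: { unfold G. rewrite RtoC_minus. ring. }
eapply Rle_trans; [apply Cmod_triangle|].
rewrite !Cmod_mult, !Cmod_R, Cmod_Cis, !Rabs_pos_eq by lra.
pose proof (Cmod_ge_0 c). nra.
Qed.

Lemma G_fst_diff s t :
  differentiable_pt_lim (fun u v => fst (G u v)) s t (cos t - fst c) (- s * sin t).
Proof.
eapply differentiable_pt_lim_ext.
{ exists (mkposreal 1 Rlt_0_1). intros u v _ _.
  instantiate (1 := fun u v => fst c + u * (cos v - fst c)). simpl. ring. }
replace (cos t - fst c) with (0 + ((cos t - fst c) * 1 + s * 0)) by ring.
replace (- s * sin t) with (0 + ((cos t - fst c) * 0 + s * (- sin t))) by ring.
apply (differentiable_pt_lim_plus (fun _ _ => fst c)).
{ apply (differentiable_pt_lim_fst (fun _ => fst c)). auto_derive; [easy|ring]. }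
apply (differentiable_pt_lim_mult (fun u _ => u) (fun _ v => cos v - fst c)).
- apply (differentiable_pt_lim_fst (fun u => u)). auto_derive; [easy|ring].
- apply (differentiable_pt_lim_snd (fun v => cos v - fst c)). auto_derive; [easy|ring].
Qed.

Lemma G_snd_diff s t :
  differentiable_pt_lim (fun u v => snd (G u v)) s t (sin t - snd c) (s * cos t).
Proof.
eapply differentiable_pt_lim_ext.
{ exists (mkposreal 1 Rlt_0_1). intros u v _ _.
  instantiate (1 := fun u v => snd c + u * (sin v - snd c)). simpl. ring. }
replace (sin t - snd c) with (0 + ((sin t - snd c) * 1 + s * 0)) by ring.
replace (s * cos t) with (0 + ((sin t - snd c) * 0 + s * (cos t))) by ring.
apply (differentiable_pt_lim_plus (fun _ _ => snd c)).
{ apply (differentiable_pt_lim_fst (fun _ => snd c)). auto_derive; [easy|ring]. }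
apply (differentiable_pt_lim_mult (fun u _ => u) (fun _ v => sin v - snd c)).
- apply (differentiable_pt_lim_fst (fun u => u)). auto_derive; [easy|ring].
- apply (differentiable_pt_lim_snd (fun v => sin v - snd c)). auto_derive; [easy|ring].
Qed.

Lemma kap_derive t : exists k1 k2,
  is_derive (fun t => fst (kap t)) t k1 /\ is_derive (fun t => snd (kap t)) t k2.
Proof.
pose proof (Cis_sub_sqr_pos t) as Hp.
unfold kap, Cis. simpl.
eexists; eexists; split; auto_derive; try reflexivity; simpl in Hp; repeat split; lra.
Qed.

(** Chain rule with the Cauchy-Riemann equations, [a + i b] being the derivative of [F] at [G s t].
    The factor [s] of the [t]-derivatives is kept in front, to cancel the [/ s] of [P]. *)
Lemma FG_diff s t : 0 <= s <= 1 -> exists a b,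
  let xs := cos t - fst c in let ys := sin t - snd c in
  differentiable_pt_lim (fun u v => fst (F (G u v))) s t
    (a * xs - b * ys) (s * (- a * sin t - b * cos t)) /\
  differentiable_pt_lim (fun u v => snd (F (G u v))) s t
    (b * xs + a * ys) (s * (- b * sin t + a * cos t)).
Proof.
intros Hs. destruct (HF _ (G_in_disc s t Hs)) as [[a b] Hd].
rewrite (surjective_pairing (G s t)) in Hd. apply cauchy_riemann in Hd as [H1 H2].
exists a, b. intros xs ys. split.
- replace (a * xs - b * ys) with (a * xs + - b * ys) by ring.
  replace (s * _) with (a * (- s * sin t) + - b * (s * cos t)) by ring.
  eapply differentiable_pt_lim_ext.
  2: { apply (differentiable_pt_lim_comp (fun u v => fst (F (u, v)))
      (fun u v => fst (G u v)) (fun u v => snd (G u v))).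
    - exact H1. - apply G_fst_diff. - apply G_snd_diff. }
  exists (mkposreal 1 Rlt_0_1). intros u v _ _. now rewrite <- (surjective_pairing (G u v)).
- replace (s * _) with (b * (- s * sin t) + a * (s * cos t)) by ring.
  eapply differentiable_pt_lim_ext.
  2: { apply (differentiable_pt_lim_comp (fun u v => snd (F (u, v)))
      (fun u v => fst (G u v)) (fun u v => snd (G u v))).
    - exact H2. - apply G_fst_diff. - apply G_snd_diff. }
  exists (mkposreal 1 Rlt_0_1). intros u v _ _. now rewrite <- (surjective_pairing (G u v)).
Qed.

Let P (s t : R) : R := / s * snd (F (G s t)).
Let Q (s t : R) : R := fst (F (G s t)) * fst (kap t) + (- snd (kap t)) * snd (F (G s t)).

(** The components of [kap t * (Cis t - c) = Cis t], where [Cis t - c] is the [s]-derivative of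
    [G]. *)
Lemma kap_mul t : 
  fst (kap t) * (cos t - fst c) - snd (kap t) * (sin t - snd c) = cos t /\
  snd (kap t) * (cos t - fst c) + fst (kap t) * (sin t - snd c) = sin t.
Proof.
assert (E : (kap t * (Cis t - c))%C = Cis t) by (unfold kap; field; apply Cis_sub_neq).
split.
- transitivity (fst (kap t * (Cis t - c))%C); [simpl; ring|now rewrite E].
- transitivity (snd (kap t * (Cis t - c))%C); [simpl; ring|now rewrite E].
Qed.

Lemma Q_diff s t : 0 <= s <= 1 -> exists a b q,
  differentiable_pt_lim (fun u v => snd (F (G u v))) s t
    (b * (cos t - fst c) + a * (sin t - snd c)) (s * (- b * sin t + a * cos t)) /\
  differentiable_pt_lim Q s t (- b * sin t + a * cos t) q.
Proof.
intros Hs. destruct (FG_diff s t Hs) as (a & b & H1 & H2). simpl in H1, H2.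
destruct (kap_derive t) as (k1 & k2 & K1 & K2). destruct (kap_mul t) as [M1 M2].
exists a, b. eexists. split; [exact H2|].
replace (- b * sin t + a * cos t) with
  ((fst (kap t) * (a * (cos t - fst c) - b * (sin t - snd c)) + fst (F (G s t)) * 0)
  + (snd (F (G s t)) * 0 + (- snd (kap t)) * (b * (cos t - fst c) + a * (sin t - snd c)))).
2: { transitivity (- b * (snd (kap t) * (cos t - fst c) + fst (kap t) * (sin t - snd c))
      + a * (fst (kap t) * (cos t - fst c) - snd (kap t) * (sin t - snd c))).
    - ring.
    - rewrite M1, M2. reflexivity. }
apply (differentiable_pt_lim_plus (fun s t => fst (F (G s t)) * fst (kap t))
   (fun s t => - snd (kap t) * snd (F (G s t)))).
- apply (differentiable_pt_lim_mult (fun s t => fst (F (G s t))) (fun _ t => fst (kap t))).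
  + exact H1.
  + apply (differentiable_pt_lim_snd (fun t => fst (kap t))). exact K1.
- apply (differentiable_pt_lim_mult (fun _ t => - snd (kap t)) (fun s t => snd (F (G s t)))).
  + apply (differentiable_pt_lim_snd (fun t => - snd (kap t))).
    apply (is_derive_opp (fun t => snd (kap t))). exact K2.
  + exact H2.
Qed.

Lemma Q_integrable s : 0 <= s <= 1 -> ex_RInt (Q s) 0 (2 * PI).
Proof.
intros Hs. apply (ex_RInt_continuous (V := R_CompleteNormedModule)). intros t _.
destruct (Q_diff s t Hs) as (a & b & q & _ & H).
eapply differentiable_continuous_y; exact H.
Qed.

(** Goursat on [[s, 1] x [0, 2 PI]]: the sides [t = 0] and [t = 2 PI] cancel by periodicity, and
    [s > 0] keeps [P] differentiable. *)
Lemma Q_integral_const s : 0 < s <= 1 -> RInt (Q 1) 0 (2 * PI) = RInt (Q s) 0 (2 * PI).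
Proof.
intros Hs.
assert (PI0 := PI_RGT_0).
pose proof (green_goursat P Q s 0 (1 - s) (2 * PI)) as H.
rewrite Rplus_0_l in H. replace (s + (1 - s)) with 1 in H by ring.
assert (E1 : RInt (fun x => P x 0 - P x (2 * PI)) s 1 = 0).
{ rewrite (RInt_ext _ (fun _ => 0)).
  - rewrite RInt_const. unfold scal; simpl; unfold mult; simpl. ring.
  - intros x _. unfold P, G, Cis. rewrite cos_2PI, sin_2PI, cos_0, sin_0. apply Rminus_eq_0. }
rewrite E1 in H. clear E1.
assert (E2 : RInt (fun t => Q 1 t - Q s t) 0 (2 * PI) = RInt (Q 1) 0 (2 * PI) - RInt (Q s) 0 (2 * PI)).
{ apply (RInt_minus (V := R_CompleteNormedModule) (Q 1) (Q s)); apply Q_integrable; lra. }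
rewrite E2 in H. enough (0 + (RInt (Q 1) 0 (2 * PI) - RInt (Q s) 0 (2 * PI)) = 0) by lra.
apply H; [lra|lra|]. intros x y Hx Hy.
destruct (Q_diff x y) as (a & b & q & D1 & D2); [lra|].
eexists; exists (- b * sin y + a * cos y), q. split; [|exact D2].
replace (- b * sin y + a * cos y) with
  (snd (F (G x y)) * 0 + / x * (x * (- b * sin y + a * cos y))) by (field; lra).
apply (differentiable_pt_lim_mult (fun x _ => / x) (fun x y => snd (F (G x y)))).
- apply (differentiable_pt_lim_fst (fun x => / x)).
  auto_derive; [lra|reflexivity].
- exact D1.
Qed.

Lemma kap_bound t : Cmod (kap t) <= / (1 - Cmod c).
Proof.
unfold kap. rewrite Cmod_div by apply Cis_sub_neq. rewrite Cmod_Cis.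
unfold Rdiv. rewrite Rmult_1_l. apply Rinv_le_contravar; [lra|].
pose proof (Cmod_sub_lower (Cis t) c). rewrite Cmod_Cis in H. lra.
Qed.

Lemma C_ex_derive_continuous (z : C) : C_ex_derive F z ->
  forall eps : posreal, exists del : posreal, forall w, Cmod (w - z) < del ->
    Cmod (F w - F z) <= eps.
Proof.
intros [l Hl] eps. rewrite C_is_derive_iff in Hl.
destruct (Hl (mkposreal 1 Rlt_0_1)) as [d Hd]. simpl in Hd.
pose proof (Cmod_ge_0 l) as Pl. pose proof (cond_pos eps) as Pe.
assert (Hp : 0 < eps / (1 + Cmod l)) by (apply Rdiv_lt_0_compat; lra).
exists (mkposreal _ (Rmin_pos _ _ (cond_pos d) Hp)). simpl. intros w Hw.
assert (W1 : Cmod (w - z) < d) by (eapply Rlt_le_trans; [exact Hw|apply Rmin_l]).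
assert (W2 : Cmod (w - z) < eps / (1 + Cmod l)) by (eapply Rlt_le_trans; [exact Hw|apply Rmin_r]).
specialize (Hd w W1).
replace (F w - F z)%C with (F w - F z - l * (w - z) + l * (w - z))%C by ring.
eapply Rle_trans; [apply Cmod_triangle|]. rewrite Cmod_mult.
apply Rlt_div_r in W2; lra.
Qed.

(** The two sides are the integrals of [Q 1] and [Q 0]. The integral of [Q s] is constant for
    [0 < s <= 1], and it tends to that of [Q 0] because [F] is continuous at [c] and [kap] is
    bounded. *)
Lemma homotopy_to_centre :
  RInt (fun t => fst (F (Cis t) * kap t)%C) 0 (2 * PI)
  = RInt (fun t => fst (F c * kap t)%C) 0 (2 * PI).
Proof.
assert (PI0 := PI_RGT_0).
transitivity (RInt (Q 1) 0 (2 * PI)).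
{ apply RInt_ext. intros t _. unfold Q, G.
  replace (c + 1 * (Cis t - c))%C with (Cis t) by ring. simpl. ring. }
transitivity (RInt (Q 0) 0 (2 * PI)).
2: { apply RInt_ext. intros t _. unfold Q, G.
  replace (c + 0 * (Cis t - c))%C with c by ring. simpl. ring. }
apply cond_eq. intros eps Heps.
(* Twice the bound [2 PI / (1 - Cmod c)] on the integral of [Cmod (kap t)], so that the error comes
   out as [eps / 2]. *)
set (M := 4 * PI * / (1 - Cmod c)).
assert (HM : 0 < M).
{ unfold M. apply Rmult_lt_0_compat; [lra|apply Rinv_0_lt_compat; lra]. }
assert (He : 0 < eps / M) by (apply Rdiv_lt_0_compat; lra).
destruct (C_ex_derive_continuous c (HF c (Rlt_le _ _ Hc)) (mkposreal _ He)) as [d Hd].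
simpl in Hd.
(* [Cmod (Cis t - c) < 2], so [G s t] is within [2 * d / 3 < d] of [c]. *)
set (s := Rmin 1 (d / 3)).
pose proof (cond_pos d) as Pd.
assert (Hs : 0 < s <= 1) by (split; [apply Rmin_pos; lra|apply Rmin_l]).
assert (Hs' : s <= d / 3) by apply Rmin_r.
rewrite (Q_integral_const s Hs).
replace (RInt (Q s) 0 (2 * PI) - RInt (Q 0) 0 (2 * PI)) with
  (RInt (fun t => Q s t - Q 0 t) 0 (2 * PI)).
2: { apply (RInt_minus (V := R_CompleteNormedModule) (Q s) (Q 0)); apply Q_integrable; lra. }
eapply Rle_lt_trans.
{ apply (abs_RInt_le_const _ _ _ (eps / M * / (1 - Cmod c))); [lra| |].
  - apply (ex_RInt_minus (V := R_NormedModule) (Q s) (Q 0)); apply Q_integrable; lra.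
  - intros t _.
    replace (Q s t - Q 0 t) with (fst ((F (G s t) - F c) * kap t)%C).
    2: { unfold Q. replace (G 0 t) with c by (unfold G; ring). simpl. ring. }
    eapply Rle_trans; [apply re_le_Cmod|]. rewrite Cmod_mult.
    apply Rmult_le_compat; try apply Cmod_ge_0; [|apply kap_bound].
    apply Hd. unfold G.
    replace (c + s * (Cis t - c) - c)%C with (RtoC s * (Cis t - c))%C by ring.
    rewrite Cmod_mult, Cmod_R, Rabs_pos_eq by lra.
    pose proof (Cmod_triangle (Cis t) (- c)%C) as T. rewrite Cmod_opp, Cmod_Cis in T.
    change (Cis t + - c)%C with (Cis t - c)%C in T.
    assert (0 <= Cmod (Cis t - c)) by apply Cmod_ge_0. nra. }
replace ((2 * PI - 0) * _) with (eps / 2); [lra|].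
unfold M. field. split; lra.
Qed.

Lemma homotopy_integrable : ex_RInt (fun t => fst (F (Cis t) * kap t)%C) 0 (2 * PI).
Proof.
apply (ex_RInt_ext (Q 1)); [|apply Q_integrable; lra].
intros t _. unfold Q, G. replace (c + 1 * (Cis t - c))%C with (Cis t) by ring. simpl. ring.
Qed.

End Homotopy.

(** * Complex derivatives and integrals over the circle *)

Lemma C_ex_derive_affine (al be z : C) : C_ex_derive (fun w => al * w + be)%C z.
Proof.
exists al. apply C_is_derive_iff. intros eps. exists (mkposreal 1 Rlt_0_1). intros w _.
replace (_ - _ - _)%C with (RtoC 0) by ring. rewrite Cmod_0.
apply Rmult_le_pos; [left; apply cond_pos|apply Cmod_ge_0].
Qed.

Lemma C_is_derive_inv (z : C) : z <> 0 -> C_is_derive Cinv z (- / (z * z))%C.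
Proof.
intros Hz. pose proof (proj1 (Cmod_gt_0 z) Hz) as Pz.
apply C_is_derive_iff. intros eps. pose proof (cond_pos eps) as Pe.
assert (H1 : 0 < Cmod z / 2) by lra.
assert (H2 : 0 < eps * (Cmod z * Cmod z * Cmod z / 2)).
{ apply Rmult_lt_0_compat; [easy|]. assert (0 < Cmod z * Cmod z) by nra. nra. }
(* The first radius gives [Cmod w > Cmod z / 2]; with the second, the remainder
   [(w - z)^2 / (w z^2)] is at most [eps * Cmod (w - z)]. *)
exists (mkposreal _ (Rmin_pos _ _ H1 H2)). simpl. intros w Hw.
assert (W1 : Cmod (w - z) < Cmod z / 2) by (eapply Rlt_le_trans; [exact Hw|apply Rmin_l]).
assert (W2 := Rlt_le_trans _ _ _ Hw (Rmin_r _ _)).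
pose proof (Cmod_sub_lower z (z - w)) as Hl.
replace (z - (z - w))%C with w in Hl by ring.
rewrite <- (Cmod_opp (z - w)) in Hl. replace (- (z - w))%C with (w - z)%C in Hl by ring.
assert (Hw0 : w <> 0) by (apply Cmod_gt_0; lra).
replace (/ w - / z - - / (z * z) * (w - z))%C with ((w - z) * (w - z) * / (w * (z * z)))%C.
2: { field. split; easy. }
rewrite !Cmod_mult, Cmod_inv, !Cmod_mult.
2: { apply Cmult_neq_0; [easy|]. now apply Cmult_neq_0. }
set (d := Cmod (w - z)) in *. set (r := Cmod z) in *. set (q := Cmod w) in *.
assert (0 <= d) by apply Cmod_ge_0.
assert (0 < q * (r * r)) by (apply Rmult_lt_0_compat; nra).
rewrite Rmult_assoc, (Rmult_comm eps). apply Rmult_le_compat_l; [easy|].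
apply Rle_div_l; [easy|].
apply Rle_trans with (eps * (r * r * r / 2)); [lra|].
apply Rmult_le_compat_l; [lra|]. nra.
Qed.

Lemma C_ex_derive_inv_affine (al be z : C) :
  (al * z + be)%C <> 0 -> C_ex_derive (fun w => / (al * w + be))%C z.
Proof.
intros H.
apply (ex_derive_comp (K := C_AbsRing) (V := AbsRing_NormedModule C_AbsRing)
  Cinv (fun w => al * w + be)%C).
- eexists. now apply C_is_derive_inv.
- apply C_ex_derive_affine.
Qed.

Lemma C_ex_derive_mult (f g : C -> C) (z : C) :
  C_ex_derive f z -> C_ex_derive g z -> C_ex_derive (fun w => f w * g w)%C z.
Proof.
intros [l Hl] [m Hm]. eexists.
apply (is_derive_mult (K := C_AbsRing) f g); [exact Hl|exact Hm|exact Cmult_comm].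
Qed.

Lemma C_ex_derive_const (k z : C) : C_ex_derive (fun _ => k) z.
Proof. apply (ex_derive_const (K := C_AbsRing) (V := AbsRing_NormedModule C_AbsRing)). Qed.

(** Componentwise, to match the separate real and imaginary parts in [torus_integral]. *)
Definition is_CInt (g : R -> C) (v : C) : Prop :=
  is_RInt (fun t => fst (g t)) 0 (2 * PI) (fst v) /\
  is_RInt (fun t => snd (g t)) 0 (2 * PI) (snd v).

Lemma is_CInt_ext (f g : R -> C) v :
  (forall t, f t = g t) -> is_CInt f v -> is_CInt g v.
Proof.
intros E [H1 H2]. split.
- apply (is_RInt_ext (fun t => fst (f t))); [|exact H1]. intros t _; now rewrite E.
- apply (is_RInt_ext (fun t => snd (f t))); [|exact H2]. intros t _; now rewrite E.
Qed.

Lemma is_CInt_scal (k : C) (g : R -> C) v :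
  is_CInt g v -> is_CInt (fun t => k * g t)%C (k * v)%C.
Proof.
intros [H1 H2]. split.
- apply (is_RInt_minus (V := R_NormedModule) (fun t => fst k * fst (g t)) (fun t => snd k * snd (g t)));
  now apply (is_RInt_scal (V := R_NormedModule)).
- apply (is_RInt_plus (V := R_NormedModule) (fun t => fst k * snd (g t)) (fun t => snd k * fst (g t)));
  now apply (is_RInt_scal (V := R_NormedModule)).
Qed.

Lemma is_CInt_const (k : C) : is_CInt (fun _ => k) (RtoC (2 * PI) * k)%C.
Proof.
split.
- replace (fst (RtoC (2 * PI) * k)%C) with (scal (2 * PI - 0) (fst k)).
  + apply (is_RInt_const (V := R_NormedModule)).
  + unfold scal; simpl; unfold mult; simpl; ring.
- replace (snd (RtoC (2 * PI) * k)%C) with (scal (2 * PI - 0) (snd k)).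
  + apply (is_RInt_const (V := R_NormedModule)).
  + unfold scal; simpl; unfold mult; simpl; ring.
Qed.

(** [homotopy_to_centre] concerns real parts; the imaginary part is the real part for [- Ci * F]. *)
Lemma is_CInt_homotopy (F : C -> C) (c v : C) :
  Cmod c < 1 -> (forall z, Cmod z <= 1 -> C_ex_derive F z) ->
  is_CInt (fun t => F c * (Cis t / (Cis t - c)))%C v ->
  is_CInt (fun t => F (Cis t) * (Cis t / (Cis t - c)))%C v.
Proof.
intros Hc HF [H1 H2].
set (F' := fun z => (- Ci * F z)%C).
assert (HF' : forall z, Cmod z <= 1 -> C_ex_derive F' z).
{ intros z Hz. apply C_ex_derive_mult; [apply C_ex_derive_const|auto]. }
assert (E : forall z w, (snd (F z * w) = fst (F' z * w))%C).
{ intros z w. unfold F', Ci. simpl. ring. }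
split.
- rewrite <- (is_RInt_unique _ _ _ _ H1).
  rewrite <- (homotopy_to_centre F c Hc HF).
  apply (RInt_correct (V := R_CompleteNormedModule)). now apply homotopy_integrable.
- rewrite <- (is_RInt_unique _ _ _ _ H2).
  apply (is_RInt_ext (fun t => fst (F' (Cis t) * (Cis t / (Cis t - c)))%C)).
  { intros t _. symmetry. apply E. }
  rewrite (RInt_ext (fun t => snd _) (fun t => fst (F' c * (Cis t / (Cis t - c)))%C)) by (intros; apply E).
  rewrite <- (homotopy_to_centre F' c Hc HF').
  apply (RInt_correct (V := R_CompleteNormedModule)). now apply homotopy_integrable.
Qed.

Lemma Cis_neq_0 t : Cis t <> 0.
Proof. apply Cmod_gt_0. rewrite Cmod_Cis. lra. Qed.

Lemma Cis_conj t : (Cis t * Cconj (Cis t))%C = 1.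
Proof.
unfold Cis, Cconj, Cmult; simpl. unfold RtoC.
pose proof (sin2_cos2 t) as H. unfold Rsqr in H.
apply injective_projections; simpl; [lra|ring].
Qed.

(** The case [c = 0], in which the kernel is identically 1. *)
Lemma mean_value (F : C -> C) :
  (forall z, Cmod z <= 1 -> C_ex_derive F z) ->
  is_CInt (fun t => F (Cis t)) (RtoC (2 * PI) * F 0)%C.
Proof.
intros HF.
assert (E : forall t, (Cis t / (Cis t - 0))%C = 1).
{ intros t. replace (Cis t - 0)%C with (Cis t) by ring. field. apply Cis_neq_0. }
apply (is_CInt_ext (fun t => F (Cis t) * (Cis t / (Cis t - 0)))%C).
{ intros t. rewrite E. ring. }
apply is_CInt_homotopy; [rewrite Cmod_0; lra|easy|].
apply (is_CInt_ext (fun t => F 0)); [|apply is_CInt_const].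
intros t. rewrite E. ring.
Qed.

(* On the circle the Cauchy kernel is the conjugate of [1 / (1 - conj c * z)],
   which is holomorphic in the disc. *)
Lemma cauchy_kernel_integral (c : C) : Cmod c < 1 ->
  is_CInt (fun t => Cis t / (Cis t - c))%C (RtoC (2 * PI)).
Proof.
intros Hc.
assert (Hnz : forall z, Cmod z <= 1 -> (- Cconj c * z + 1)%C <> 0).
{ intros z Hz. apply Cmod_gt_0.
  replace (- Cconj c * z + 1)%C with (1 - Cconj c * z)%C by ring.
  pose proof (Cmod_sub_lower 1 (Cconj c * z)) as H.
  rewrite Cmod_mult, Cmod_conj, Cmod_1 in H.
  pose proof (Cmod_ge_0 c). pose proof (Cmod_ge_0 z). nra. }
destruct (mean_value (fun z => / (- Cconj c * z + 1))%C) as [H1 H2].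
{ intros z Hz. apply C_ex_derive_inv_affine. auto. }
assert (E : forall t, (Cis t / (Cis t - c))%C = Cconj (/ (- Cconj c * Cis t + 1))).
{ intros t. 
  assert (N : (Cis t - c)%C <> 0) by now apply Cis_sub_neq.
  rewrite Cinv_conj by (apply Hnz; rewrite Cmod_Cis; lra).
  rewrite Cplus_conj, Cmult_conj, Copp_conj, Cconj_conj.
  (* Writing 1 as [z * conj z] lets [conj z] factor out of the denominator [1 - c * conj z]. *)
  replace (Cconj 1) with (Cis t * Cconj (Cis t))%C.
  2: { rewrite Cis_conj. unfold Cconj, RtoC; simpl. f_equal. ring. }
  replace (- c * Cconj (Cis t) + Cis t * Cconj (Cis t))%C with (Cconj (Cis t) * (Cis t - c))%C by ring.
  assert (N2 : Cconj (Cis t) <> 0).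
  { intros N2. pose proof (Cis_conj t) as N3. rewrite N2, Cmult_0_r in N3.
    injection N3. lra. }
  transitivity (Cis t * Cconj (Cis t) / (Cconj (Cis t) * (Cis t - c)))%C.
  - field. split; easy.
  - rewrite Cis_conj. field. split; easy. }
assert (V : (RtoC (2 * PI) * / (- Cconj c * 0 + 1))%C = RtoC (2 * PI)).
{ replace (- Cconj c * 0 + 1)%C with (RtoC 1) by ring. field. }
rewrite V in H1, H2. split.
- apply (is_RInt_ext _ _ _ _ _ (fun t _ => eq_sym (f_equal fst (E t)))). exact H1.
- apply (is_RInt_ext _ _ _ _ _ (fun t _ => eq_sym (f_equal snd (E t)))).
  replace (snd (RtoC (2 * PI))) with (opp (snd (RtoC (2 * PI)))) by apply Ropp_0.
  exact (is_RInt_opp (V := R_NormedModule) _ _ _ _ H2).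
Qed.

(** With [z = Cis t], the expression [z dt / (z - c)] is [dz / (i (z - c))], whence the constant
    [2 PI] without [i]. *)
Lemma cauchy_disc (F : C -> C) (c : C) :
  Cmod c < 1 -> (forall z, Cmod z <= 1 -> C_ex_derive F z) ->
  is_CInt (fun t => F (Cis t) * (Cis t / (Cis t - c)))%C (RtoC (2 * PI) * F c)%C.
Proof.
intros Hc HF. apply is_CInt_homotopy; [easy|easy|].
rewrite Cmult_comm. apply is_CInt_scal, cauchy_kernel_integral; easy.
Qed.

(** * Elimination of one variable *)

(* [ring] does not see through [Cx], the name of the complex numbers in [Defs]. *)
Ltac Cx_ring := match goal with |- @eq _ ?a ?b => change (@eq C a b); ring end.

Definition scons (x : R) (s : nat -> R) (j : nat) : R :=
  match j with O => x | S i => s i end.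

Definition vcons (x : Cx) (z : cvec) : cvec := fun j =>
  match j with O => x | S i => z i end.

(* [iter_int] peels off the outermost variable; this peels off the innermost. *)
Lemma iter_int_inner (n : nat) (g g' : (nat -> R) -> R) (v : R) :
  (forall th, is_RInt (fun t => g (scons t th)) 0 (2 * PI) (g' th)) ->
  iter_int n g' v -> iter_int (S n) g v.
Proof.
revert g g' v. induction n as [|n IH]; intros g g' v Hg Hv.
(* [iter_int O] evaluates at the zero angles, and updating their entry 0 to [t] is [scons t] of zero
   angles. *)
- exists (fun t => g (scons t (fun _ => 0))). split.
  { intros t. simpl. f_equal. apply functional_extensionality. intros [|j]; reflexivity. }
  assert (E := ex_intro _ _ (Hg (fun _ => 0)) : ex_RInt _ 0 (2 * PI)).
  exists (ex_RInt_Reals_0 _ _ _ E). rewrite <- RInt_Reals.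
  rewrite (is_RInt_unique _ _ _ _ (Hg (fun _ => 0))). symmetry. exact Hv.
- destruct Hv as (h & Hh & Hint). exists h. split; [|exact Hint].
  (* Fixing the outermost angle commutes with adjoining the innermost one: [upd (scons s th) (S n) t
     = scons s (upd th n t)]. *)
  intros t. apply (IH _ (fun th => g' (upd th n t))); [|apply Hh].
  intros th. apply (is_RInt_ext (fun s => g (scons s (upd th n t)))); [|apply Hg].
  intros s _. f_equal. apply functional_extensionality. intros [|j]; reflexivity.
Qed.

(** * Finite sums and products *)

Lemma Csum_ext n (f g : nat -> C) :
  (forall j, (j < n)%nat -> f j = g j) -> Csum n f = Csum n g.
Proof.
induction n as [|n IH]; intros H; simpl; [easy|].
rewrite H, IH by auto. reflexivity.
Qed.

Lemma Cprod_ext n (f g : nat -> C) :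
  (forall j, (j < n)%nat -> f j = g j) -> Cprod n f = Cprod n g.
Proof.
induction n as [|n IH]; intros H; simpl; [easy|].
rewrite H, IH by auto. reflexivity.
Qed.

Lemma Csum_S_l n (f : nat -> C) : Csum (S n) f = (f O + Csum n (fun j => f (S j)))%C.
Proof.
induction n as [|n IH].
- change ((0 + f O)%C = (f O + 0)%C). ring.
- change ((Csum (S n) f + f (S n))%C = (f O + (Csum n (fun j => f (S j)) + f (S n)))%C).
  rewrite IH. ring.
Qed.

Lemma Cprod_S_l n (f : nat -> C) : Cprod (S n) f = (f O * Cprod n (fun j => f (S j)))%C.
Proof.
induction n as [|n IH].
- change ((1 * f O)%C = (f O * 1)%C). ring.
- change ((Cprod (S n) f * f (S n))%C = (f O * (Cprod n (fun j => f (S j)) * f (S n)))%C).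
  rewrite IH. ring.
Qed.

Lemma Csum_linear n (k : C) (f g : nat -> C) :
  Csum n (fun j => f j + k * g j)%C = (Csum n f + k * Csum n g)%C.
Proof.
induction n as [|n IH].
- change (RtoC 0 = (0 + k * 0)%C). ring.
- change ((Csum n (fun j => f j + k * g j) + (f n + k * g n))%C
    = ((Csum n f + f n) + k * (Csum n g + g n))%C).
  rewrite IH. ring.
Qed.

Lemma Csum_scal n (k : C) (f : nat -> C) :
  Csum n (fun j => k * f j)%C = (k * Csum n f)%C.
Proof.
induction n as [|n IH].
- change (RtoC 0 = (k * 0)%C). ring.
- change ((Csum n (fun j => k * f j) + k * f n)%C = (k * (Csum n f + f n))%C).
  rewrite IH. ring.
Qed.

Lemma Cprod_mul n (f g : nat -> C) :
  Cprod n (fun j => f j * g j)%C = (Cprod n f * Cprod n g)%C.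
Proof.
induction n as [|n IH].
- change (RtoC 1 = (1 * 1)%C). ring.
- change ((Cprod n (fun j => f j * g j) * (f n * g n))%C
    = ((Cprod n f * f n) * (Cprod n g * g n))%C).
  rewrite IH. ring.
Qed.

Lemma Cprod_inv n (f : nat -> C) : (forall j, (j < n)%nat -> f j <> 0) ->
  Cprod n f <> RtoC 0 /\ Cprod n (fun j => / f j)%C = (/ Cprod n f)%C.
Proof.
induction n as [|n IH]; intros H.
- split; [intros [=]; lra|]. change (RtoC 1 = (/ 1)%C). field.
- destruct IH as [N E]; [auto|]. assert (Hn : f n <> 0) by auto.
  split; [apply Cmult_neq_0; easy|].
  change ((Cprod n (fun j => / f j) * / f n)%C = (/ (Cprod n f * f n))%C).
  rewrite E. field. split; easy.
Qed.

Lemma Cprod_const n (k : C) : Cprod n (fun _ => k) = (k ^ n)%C.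
Proof.
induction n as [|n IH]; [reflexivity|].
change ((Cprod n (fun _ => k) * k)%C = (k * k ^ n)%C). rewrite IH. ring.
Qed.

Lemma Cprod_ex_derive n (g : nat -> C -> C) z :
  (forall i, (i < n)%nat -> C_ex_derive (g i) z) ->
  C_ex_derive (fun w => Cprod n (fun i => g i w)) z.
Proof.
induction n as [|n IH]; intros H.
{ change (C_ex_derive (fun _ => RtoC 1) z). apply C_ex_derive_const. }
change (C_ex_derive (fun w => Cprod n (fun i => g i w) * g n w)%C z).
apply (C_ex_derive_mult (fun w => Cprod n (fun i => g i w)) (g n)); auto.
Qed.

Lemma Rsum_S_l n (f : nat -> R) : Rsum (S n) f = f O + Rsum n (fun j => f (S j)).
Proof. induction n as [|n IH]; [simpl; ring|]. simpl in *. rewrite IH. ring. Qed.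

Lemma Rsum_le n (f g : nat -> R) :
  (forall j, (j < n)%nat -> f j <= g j) -> Rsum n f <= Rsum n g.
Proof.
induction n as [|n IH]; intros H; simpl; [lra|].
assert (Rsum n f <= Rsum n g) by auto. pose proof (H n ltac:(lia)). lra.
Qed.

Lemma Rsum_ge_0 n (f : nat -> R) :
  (forall j, (j < n)%nat -> 0 <= f j) -> 0 <= Rsum n f.
Proof.
intros H. apply Rle_trans with (Rsum n (fun _ => 0)); [|now apply Rsum_le].
clear. induction n; simpl; lra.
Qed.

Lemma Rsum_ge_term n (f : nat -> R) i :
  (forall j, (j < n)%nat -> 0 <= f j) -> (i < n)%nat -> f i <= Rsum n f.
Proof.
induction n as [|n IH]; intros H Hi; [lia|]. simpl.
assert (0 <= Rsum n f) by (apply Rsum_ge_0; auto).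
destruct (Nat.eq_dec i n) as [->|Hne]; [lra|].
assert (f i <= Rsum n f) by (apply IH; auto; lia). pose proof (H n ltac:(lia)). lra.
Qed.

Lemma Rsum_linear n (k : R) (f g : nat -> R) :
  Rsum n (fun j => f j + k * g j) = Rsum n f + k * Rsum n g.
Proof. induction n as [|n IH]; simpl; [ring|]. rewrite IH. ring. Qed.

Lemma Cmod_Csum_le n (f : nat -> C) : Cmod (Csum n f) <= Rsum n (fun j => Cmod (f j)).
Proof.
induction n as [|n IH]; [simpl; change (Cmod 0 <= 0); rewrite Cmod_0; lra|].
simpl. eapply Rle_trans; [apply Cmod_triangle|]. lra.
Qed.

Lemma Rsum_split n (f : nat -> R) i : (i < n)%nat ->
  Rsum n f = Rsum n (fun j => if Nat.eqb j i then 0 else f j) + f i.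
Proof.
intros Hi. induction n as [|n IH]; [lia|]. simpl.
destruct (Nat.eqb_spec n i) as [<-|Hne]; [|rewrite IH by lia; ring].
enough (E : Rsum n f = Rsum n (fun j => if Nat.eqb j n then 0 else f j)) by lra.
clear. enough (G : forall m, (m <= n)%nat ->
  Rsum m f = Rsum m (fun j => if Nat.eqb j n then 0 else f j)) by now apply G.
induction m as [|m IH]; intros Hm; [easy|]. simpl. rewrite IH by lia.
destruct (Nat.eqb_spec m n); [lia|reflexivity].
Qed.

Lemma Csum_split n (f : nat -> C) i : (i < n)%nat ->
  Csum n f = (Csum n (fun j => if Nat.eqb j i then RtoC 0 else f j) + f i)%C.
Proof.
intros Hi. induction n as [|n IH]; [lia|]. 
change ((Csum n f + f n)%C = (Csum n (fun j => if Nat.eqb j i then RtoC 0 else f j)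
  + (if Nat.eqb n i then RtoC 0 else f n) + f i)%C).
destruct (Nat.eqb_spec n i) as [<-|Hne]; [|rewrite IH by lia; ring].
transitivity (Csum n f + 0 + f n)%C; [ring|].
apply (f_equal (fun u => (u + 0 + f n)%C)). apply Csum_ext.
intros j Hj. destruct (Nat.eqb_spec j n); [lia|reflexivity].
Qed.

(** * Diagonal dominance and the elimination step *)

Definition diag_dominant (n : nat) (A : cmat) : Prop := forall i, (i < n)%nat ->
  Rsum n (fun j => if Nat.eqb j i then 0 else Cmod (A i j)) < Cmod (A i i).

(** The diagonal term has modulus [Cmod (A i i)] and the others add up to less. The other
    coordinates are only bounded by 1, as the first variable is to range over the closed disc. *)
Lemma diag_dominant_mulmv_neq_0 n (A : cmat) (z : cvec) i :
  diag_dominant n A -> (i < n)%nat ->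
  (forall j, (j < n)%nat -> Cmod (z j) <= 1) -> Cmod (z i) = 1 ->
  mulmv n A z i <> RtoC 0.
Proof.
intros HA Hi Hz Hzi. apply Cmod_gt_0. unfold mulmv.
rewrite (Csum_split _ _ _ Hi).
set (s := Csum _ _).
assert (Hs : Cmod s < Cmod (A i i)).
{ eapply Rle_lt_trans; [|apply (HA i Hi)].
  eapply Rle_trans; [apply Cmod_Csum_le|]. apply Rsum_le. intros j Hj.
  destruct (Nat.eqb j i); [rewrite Cmod_0; lra|].
  change (Cmod (A i j * z j) <= Cmod (A i j)). rewrite Cmod_mult.
  pose proof (Hz j Hj). pose proof (Cmod_ge_0 (A i j)). nra. }
change (0 < Cmod (s + A i i * z i)).
pose proof (Cmod_sub_lower (A i i * z i) (- s)) as H.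
rewrite Cmod_opp, Cmod_mult, Hzi in H.
replace (A i i * z i - - s)%C with (s + A i i * z i)%C in H by ring. lra.
Qed.

Definition schur (A : cmat) : cmat := fun i j =>
  Csub (A (S i) (S j)) (Cmul (Cmul (A (S i) O) (Defs.Cinv (A O O))) (A O (S j))).

(** Row [S i] loses [x / a] times row 0 in modulus: the off-diagonal sum gains at most [x / a * Y],
    and the diagonal entry loses at most [x / a * y]. Dominance of row 0 gives [Y + y < a], so the
    total damage is at most [x], exactly the entry that leaves the row with the eliminated
    column. *)
Lemma schur_dominant n (A : cmat) : diag_dominant (S n) A -> diag_dominant n (schur A).
Proof.
intros HA i Hi.
pose proof (HA O ltac:(lia)) as H0. rewrite Rsum_S_l in H0.
change (0 + Rsum n (fun j => Cmod (A O (S j))) < Cmod (A O O)) in H0.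
pose proof (HA (S i) ltac:(lia)) as H1. rewrite Rsum_S_l in H1.
change (Cmod (A (S i) O) + Rsum n (fun j => if Nat.eqb j i then 0 else Cmod (A (S i) (S j)))
   < Cmod (A (S i) (S i))) in H1.
rewrite (Rsum_split _ _ _ Hi) in H0.
set (a := Cmod (A O O)) in *. set (x := Cmod (A (S i) O)) in *.
set (Y := Rsum n (fun j => if Nat.eqb j i then 0 else Cmod (A O (S j)))) in *.
set (X := Rsum n (fun j => if Nat.eqb j i then 0 else Cmod (A (S i) (S j)))) in *.
set (y := Cmod (A O (S i))) in *.
assert (HY : 0 <= Y).
{ apply Rsum_ge_0. intros j _. destruct (Nat.eqb j i); [lra|apply Cmod_ge_0]. }
assert (0 <= y) by apply Cmod_ge_0. assert (0 <= x) by apply Cmod_ge_0.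
assert (Ha : 0 < a) by lra.
assert (Hnz : A O O <> RtoC 0) by now apply Cmod_gt_0.
assert (Ecoef : forall j, Cmod (A (S i) O * / A O O * A O (S j)) = x / a * Cmod (A O (S j))).
{ intros j. rewrite !Cmod_mult, Cmod_inv by easy. reflexivity. }
assert (Hoff : Rsum n (fun j => if Nat.eqb j i then 0 else Cmod (schur A i j)) <= X + x / a * Y).
{ unfold X, Y. rewrite <- Rsum_linear. apply Rsum_le. intros j Hj.
  destruct (Nat.eqb j i); [lra|]. rewrite <- Ecoef.
  change (schur A i j) with (A (S i) (S j) + - (A (S i) O * / A O O * A O (S j)))%C.
  eapply Rle_trans; [apply Cmod_triangle|]. rewrite Cmod_opp. lra. }
assert (Hdiag : Cmod (A (S i) (S i)) - x / a * y <= Cmod (schur A i i)).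
{ unfold y. rewrite <- Ecoef. apply Cmod_sub_lower. }
assert (0 <= x / a) by (apply Rmult_le_pos; [easy|left; now apply Rinv_0_lt_compat]).
assert (x / a * a = x) by (field; lra).
assert (x / a * (Y + y) <= x / a * a) by (apply Rmult_le_compat_l; lra).
lra.
Qed.

(* Unlike [holomorphic], this is visibly stable under linear substitutions. *)
Definition line_holomorphic (k : nat) (f : cvec -> C) : Prop :=
  forall a b, supported k a -> supported k b -> forall z : C,
    C_ex_derive (fun w => f (fun j => a j + w * b j)%C) z.

(** The form [dz_1 ... dz_k / (w_1 ... w_k)] written in the angles, without its factor [i ^ k]. *)
Definition torus_kernel (k : nat) (A : cmat) (th : nat -> R) : C :=
  Cprod k (fun i => Cis (th i) / mulmv k A (torus_pt k th) i)%C.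

Lemma torus_pt_supported k th : supported k (torus_pt k th).
Proof.
intros j Hj. unfold torus_pt. destruct (Nat.ltb_spec j k); [lia|reflexivity].
Qed.

Lemma torus_pt_scons k t th :
  torus_pt (S k) (scons t th) = vcons (Cis t) (torus_pt k th).
Proof. apply functional_extensionality. intros [|j]; reflexivity. Qed.

Lemma Cmod_torus_pt k th j : (j < k)%nat -> Cmod (torus_pt k th j) = 1.
Proof.
intros Hj. unfold torus_pt. destruct (Nat.ltb_spec j k); [apply Cmod_Cis|lia].
Qed.

Lemma mulmv_vcons k (A : cmat) (x : C) (z : cvec) i :
  mulmv (S k) A (vcons x z) i = (A i O * x + Csum k (fun j => A i (S j) * z j))%C.
Proof. apply Csum_S_l. Qed.

(* The zero in the first variable of the first coordinate of [A z]. *)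
Definition pivot_root (k : nat) (A : cmat) (z : cvec) : C :=
  (- / A O O * Csum k (fun j => A O (S j) * z j))%C.

(** Origin of the Schur complement: solving [w_1 = 0] for [z_1] and substituting turns the other
    [w_i] into linear forms with this matrix. *)
Lemma mulmv_schur k (A : cmat) (z : cvec) i :
  mulmv k (schur A) z i = mulmv (S k) A (vcons (pivot_root k A z) z) (S i).
Proof.
rewrite mulmv_vcons. unfold mulmv, pivot_root.
rewrite (Csum_ext k _ (fun j => A (S i) (S j) * z j
   + (- (A (S i) O * / A O O)) * (A O (S j) * z j))%C).
2: { intros j _.
  change ((A (S i) (S j) - A (S i) O * / A O O * A O (S j)) * z j =
   A (S i) (S j) * z j + (- (A (S i) O * / A O O)) * (A O (S j) * z j))%C. ring. }
rewrite Csum_linear. Cx_ring.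
Qed.

(** What replaces [f] once the first angle is integrated out; it absorbs the constant
    [2 PI / A O O], so that the claim for [k] variables applies to it directly. *)
Definition eliminate (k : nat) (A : cmat) (f : cvec -> C) : cvec -> C := fun z =>
  (RtoC (2 * PI) * / A O O * f (vcons (pivot_root k A z) z))%C.

Lemma supported_vcons k (x : C) (z : cvec) : supported k z -> supported (S k) (vcons x z).
Proof. intros H [|j] Hj; [lia|]. apply H. lia. Qed.

(** [pivot_root] is linear in [z], so the substitution sends complex lines to complex lines. *)
Lemma eliminate_line_holomorphic k A f :
  line_holomorphic (S k) f -> line_holomorphic k (eliminate k A f).
Proof.
intros Hf a b Ha Hb z.
apply C_ex_derive_mult; [apply C_ex_derive_const|].
refine (eq_ind _ (fun g => C_ex_derive g z) (Hf (vcons (pivot_root k A a) a)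
  (vcons (pivot_root k A b) b) (supported_vcons _ _ _ Ha) (supported_vcons _ _ _ Hb) z) _ _).
apply functional_extensionality. intros w. f_equal.
apply functional_extensionality. intros [|j]; simpl; [|reflexivity].
unfold pivot_root.
rewrite (Csum_ext k (fun j => A O (S j) * (a j + w * b j))%C
  (fun j => A O (S j) * a j + w * (A O (S j) * b j))%C) by (intros; ring).
rewrite Csum_linear. ring.
Qed.

Lemma eliminate_integral k (A : cmat) (f : cvec -> C) (th : nat -> R) :
  diag_dominant (S k) A -> line_holomorphic (S k) f ->
  is_CInt (fun t => f (torus_pt (S k) (scons t th)) * torus_kernel (S k) A (scons t th))%C
    (eliminate k A f (torus_pt k th) * torus_kernel k (schur A) th)%C.
Proof.
intros HA Hf. set (z := torus_pt k th).
assert (Hzle : forall x, Cmod x <= 1 -> forall j, (j < S k)%nat -> Cmod (vcons x z j) <= 1).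
{ intros x Hx [|j] Hj; [exact Hx|]. right. apply Cmod_torus_pt. lia. }
assert (Hrow : forall i x, (i < k)%nat -> Cmod x <= 1 -> mulmv (S k) A (vcons x z) (S i) <> RtoC 0).
{ intros i x Hi Hx. apply diag_dominant_mulmv_neq_0; [easy|lia|now apply Hzle|].
  simpl. now apply Cmod_torus_pt. }
assert (Hrow0 : forall t, mulmv (S k) A (vcons (Cis t) z) O <> RtoC 0).
{ intros t. apply diag_dominant_mulmv_neq_0; [easy|lia| |apply Cmod_Cis].
  apply Hzle. rewrite Cmod_Cis. lra. }
assert (H0 : Cmod (Csum k (fun j => A O (S j) * z j)%C) < Cmod (A O O)).
{ pose proof (HA O ltac:(lia)) as H. rewrite Rsum_S_l in H.
  change (0 + Rsum k (fun j => Cmod (A O (S j))) < Cmod (A O O)) in H.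
  eapply Rle_lt_trans; [apply Cmod_Csum_le|]. eapply Rle_lt_trans; [|exact H].
  rewrite Rplus_0_l. apply Rsum_le. intros j Hj.
  unfold z. rewrite Cmod_mult, Cmod_torus_pt by easy. lra. }
assert (Ha : A O O <> RtoC 0).
{ apply Cmod_gt_0. pose proof (Cmod_ge_0 (Csum k (fun j => A O (S j) * z j)%C)). lra. }
set (c := pivot_root k A z).
assert (Hc : Cmod c < 1).
{ unfold c, pivot_root. rewrite Cmod_mult, Cmod_opp, Cmod_inv by easy.
  rewrite Rmult_comm. apply Rlt_div_l; [now apply Cmod_gt_0|lra]. }
(* Everything but the factor of row 0; by [Hrow] the denominators have no zero in the closed
   disc. *)
set (F := fun x => (f (vcons x z) *
  Cprod k (fun i => Cis (th i) * / mulmv (S k) A (vcons x z) (S i)))%C).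
assert (HF : forall x, Cmod x <= 1 -> C_ex_derive F x).
{ intros x Hx. apply C_ex_derive_mult.
  (* The line through [(0, z)] in the direction of the first coordinate. *)
  - refine (eq_ind _ (fun g => C_ex_derive g x) (Hf (vcons (RtoC 0) z) (vcons (RtoC 1) vzero) _ _ x) _ _).
    + apply supported_vcons, torus_pt_supported.
    + apply supported_vcons. intros j _. reflexivity.
    + apply functional_extensionality. intros w. f_equal.
      apply functional_extensionality. intros [|j]; simpl; [ring|].
      change ((z j + w * 0)%C = z j). ring.
  - apply Cprod_ex_derive. intros i Hi. apply C_ex_derive_mult; [apply C_ex_derive_const|].
    refine (eq_ind _ (fun g => C_ex_derive g x) (C_ex_derive_inv_affine (A (S i) O)
       (Csum k (fun j => A (S i) (S j) * z j)%C) x _) _ _).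
    + rewrite <- mulmv_vcons. now apply Hrow.
    + apply functional_extensionality. intros w. now rewrite mulmv_vcons. }
pose proof (is_CInt_scal (/ A O O)%C _ _ (cauchy_disc F c Hc HF)) as H.
replace (eliminate k A f z * torus_kernel k (schur A) th)%C
  with (/ A O O * (RtoC (2 * PI) * F c))%C.
2: { assert (E : torus_kernel k (schur A) th =
      Cprod k (fun i => Cis (th i) * / mulmv (S k) A (vcons c z) (S i))%C).
  { apply Cprod_ext. intros i _. now rewrite mulmv_schur. }
  rewrite E. unfold eliminate, F. fold c. ring. }
refine (is_CInt_ext _ _ _ _ H). intros t.
unfold torus_kernel. rewrite Cprod_S_l, torus_pt_scons. fold z.
change (/ A O O * (F (Cis t) * (Cis t / (Cis t - c))) = f (vcons (Cis t) z) *
  ((Cis t / mulmv (S k) A (vcons (Cis t) z) O) *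
   Cprod k (fun j => Cis (th j) * / mulmv (S k) A (vcons (Cis t) z) (S j))))%C.
(* The first coordinate of [A z] is [A O O * (z_1 - c)], so the factor of row 0 is the Cauchy kernel
   over [A O O]. *)
assert (E : (Cis t / mulmv (S k) A (vcons (Cis t) z) O)%C = (/ A O O * (Cis t / (Cis t - c)))%C).
{ replace (mulmv (S k) A (vcons (Cis t) z) O) with (A O O * (Cis t - c))%C.
  - field. split; [|easy]. now apply Cis_sub_neq.
  - rewrite mulmv_vcons. unfold c, pivot_root. field. easy. }
rewrite E. unfold F, Cdiv. ring.
Qed.

(** Stated for all [A] and [f] at once, since both change in the induction; [det k A <> 0] is
    carried along to justify the quotients. *)
Lemma torus_integral_dominant k (A : cmat) (f : cvec -> C) :
  diag_dominant k A -> line_holomorphic k f ->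
  det k A <> RtoC 0 /\
  let v := (RtoC (2 * PI) ^ k * (f vzero / det k A))%C in
  iter_int k (fun th => fst (f (torus_pt k th) * torus_kernel k A th)%C) (fst v) /\
  iter_int k (fun th => snd (f (torus_pt k th) * torus_kernel k A th)%C) (snd v).
Proof.
revert A f. induction k as [|k IH]; intros A f HA Hf.
- split; [intros [=]; lra|].
  change (det 0 A) with (RtoC 1). unfold torus_kernel. simpl.
  assert (E : torus_pt 0 (fun _ => 0) = vzero) by (apply functional_extensionality; reflexivity).
  rewrite E.
  change ((fst (1 * (f vzero / 1)) = fst (f vzero * 1))%C /\
     (snd (1 * (f vzero / 1)) = snd (f vzero * 1))%C).
  replace (1 * (f vzero / 1))%C with (f vzero * 1)%C by field. easy.
- destruct (IH (schur A) (eliminate k A f)) as (Hdet & H1 & H2).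
  { now apply schur_dominant. } { now apply eliminate_line_holomorphic. }
  assert (Ha : A O O <> RtoC 0).
  { apply Cmod_gt_0. eapply Rle_lt_trans; [|apply (HA O); lia].
    apply Rsum_ge_0. intros j _. destruct (Nat.eqb j O); [lra|apply Cmod_ge_0]. }
  assert (Ed : det (S k) A = (A O O * det k (schur A))%C) by (apply DetSchur.det_schur, Ha).
  split; [rewrite Ed; now apply Cmult_neq_0|].
  (* [eliminate] contributes the missing [2 PI / A O O], and [pivot_root] vanishes at 0, so [f] is
     still evaluated at 0. *)
  assert (Ev : (RtoC (2 * PI) ^ S k * (f vzero / det (S k) A))%C =
    (RtoC (2 * PI) ^ k * (eliminate k A f vzero / det k (schur A)))%C).
  { rewrite Ed. unfold eliminate.
    replace (vcons (pivot_root k A vzero) vzero) with vzero.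
    - simpl (_ ^ S k)%C. field. split; easy.
    - apply functional_extensionality. intros [|j]; [|reflexivity].
      simpl. unfold pivot_root.
      rewrite (Csum_ext k _ (fun j => 0 * A O (S j))%C).
      2: { intros j _. change (A O (S j) * 0 = 0 * A O (S j))%C. ring. }
      rewrite Csum_scal. change (vzero O) with (RtoC 0). Cx_ring. }
  rewrite Ev. split.
  + refine (iter_int_inner _ _ _ _ _ H1). intros th.
    exact (proj1 (eliminate_integral k A f th HA Hf)).
  + refine (iter_int_inner _ _ _ _ _ H2). intros th.
    exact (proj2 (eliminate_integral k A f th HA Hf)).
Qed.

(** * From holomorphy to holomorphy along lines *)

Lemma vnorm_scal k (x : C) (h : cvec) : vnorm k (fun j => x * h j)%C = Cmod x * vnorm k h.
Proof.
unfold vnorm. rewrite <- (sqrt_pow2 (Cmod x)) by apply Cmod_ge_0.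
rewrite <- sqrt_mult_alt by apply pow2_ge_0. f_equal.
change (Rsum k (fun j => Cabs (Cmul x (h j)) ^ 2)
  = Cmod x ^ 2 * Rsum k (fun j => Cabs (h j) ^ 2)).
induction k as [|k IH]; cbn [Rsum]; [ring|]. rewrite IH.
change (Cabs (Cmul x (h k))) with (Cmod (x * h k)). change (Cabs (h k)) with (Cmod (h k)).
rewrite Cmod_mult, Rpow_mult_distr. ring.
Qed.

Lemma vnorm_eq_0 k (h : cvec) : supported k h -> vnorm k h = 0 -> h = vzero.
Proof.
intros Hs H. apply functional_extensionality. intros j.
destruct (Nat.lt_ge_cases j k) as [Hj|Hj]; [|now apply Hs].
apply Cmod_eq_0.
assert (P : forall i, (i < k)%nat -> 0 <= Cabs (h i) ^ 2) by (intros; apply pow2_ge_0).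
apply sqrt_eq_0 in H; [|now apply Rsum_ge_0].
pose proof (Rsum_ge_term k (fun i => Cabs (h i) ^ 2) j P Hj) as G. rewrite H in G.
change (Cmod (h j) ^ 2 <= 0) in G. pose proof (Cmod_ge_0 (h j)). nra.
Qed.

Lemma holomorphic_line k f : holomorphic k f -> line_holomorphic k f.
Proof.
intros Hf a b Ha Hb x.
destruct (Hf (fun j => a j + x * b j)%C) as [l Hl].
{ intros j Hj. rewrite Ha, Hb by easy. change (0 + x * 0 = 0)%C. ring. }
exists (Csum k (fun j => l j * b j)%C). apply C_is_derive_iff. intros eps.
set (N := vnorm k b). assert (HN : 0 <= N) by apply sqrt_pos.
pose proof (cond_pos eps) as Pe.
(* The increment [h = (w - x) b] has norm [Cmod (w - x) * N]; adding 1 to [N] covers [b = 0]. *)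
assert (He : 0 < eps / (N + 1)) by (apply Rdiv_lt_0_compat; lra).
destruct (Hl _ He) as (d & Pd & Hd).
assert (Hd' : 0 < d / (N + 1)) by (apply Rdiv_lt_0_compat; lra).
exists (mkposreal _ Hd'). simpl. intros w Hw.
set (h := fun j => ((w - x) * b j)%C).
assert (Hsh : supported k h).
{ intros j Hj. unfold h. rewrite Hb by easy. change ((w - x) * 0 = 0)%C. ring. }
assert (Eh : vnorm k h = Cmod (w - x) * N) by apply vnorm_scal.
assert (Ez : (fun j => a j + w * b j)%C = vadd (fun j => a j + x * b j)%C h).
{ apply functional_extensionality. intros j. unfold h.
  change (a j + w * b j = a j + x * b j + (w - x) * b j)%C. ring. }
assert (El : (Csum k (fun j => l j * b j) * (w - x))%C = Csum k (fun j => l j * h j)%C).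
{ rewrite Cmult_comm, <- Csum_scal. apply Csum_ext. intros j _. unfold h. ring. }
rewrite Ez, El. pose proof (Cmod_ge_0 (w - x)) as Pw.
(* [holomorphic] constrains only increments of positive norm; a zero increment makes the remainder
   vanish. *)
destruct (Req_dec (vnorm k h) 0) as [Z|Z].
- apply (vnorm_eq_0 k h Hsh) in Z. rewrite Z.
  replace (vadd (fun j => a j + x * b j)%C vzero) with (fun j => a j + x * b j)%C.
  2: { apply functional_extensionality. intros j.
    change (a j + x * b j = a j + x * b j + 0)%C. ring. }
  rewrite (Csum_ext k _ (fun j => 0 * l j)%C).
  2: { intros j _. change (l j * 0 = 0 * l j)%C. ring. }
  rewrite Csum_scal.
  replace (_ - _ - _)%C with (RtoC 0) by ring. rewrite Cmod_0.
  apply Rmult_le_pos; lra.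
- assert (Pv : 0 < vnorm k h) by (pose proof (sqrt_pos (Rsum k (fun j => Cabs (h j) ^ 2))); unfold vnorm in *; lra).
  specialize (Hd h Hsh). eapply Rle_trans; [apply Hd; split; [easy|]|].
  + rewrite Eh. apply Rlt_div_r in Hw; [|lra]. nra.
  + rewrite Eh. replace (eps / (N + 1) * (Cmod (w - x) * N)) with
      (eps * Cmod (w - x) * (N / (N + 1))) by (field; lra).
    rewrite <- (Rmult_1_r (eps * Cmod (w - x))) at 2.
    apply Rmult_le_compat_l; [nra|]. apply Rle_div_l; lra.
Qed.

(** * The Frobenius bound *)

Lemma Rsum_lt_const n (f : nat -> R) (m : R) :
  (1 <= n)%nat -> (forall j, (j < n)%nat -> f j < m) -> Rsum n f < INR n * m.
Proof.
intros Hn. induction n as [|n IH]; [lia|]. intros H. rewrite S_INR. simpl Rsum.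
pose proof (H n ltac:(lia)) as Hm.
destruct n as [|n]; [simpl; lra|].
assert (Rsum (S n) f < INR (S n) * m) by (apply IH; [lia|auto]). lra.
Qed.

Lemma entry_le_frob k (E : cmat) i j :
  (i < k)%nat -> (j < k)%nat -> Cmod (E i j) <= frob k E.
Proof.
intros Hi Hj. rewrite <- (sqrt_pow2 (Cmod (E i j))) by apply Cmod_ge_0.
apply sqrt_le_1_alt.
eapply Rle_trans; [|apply (Rsum_ge_term k (fun i => Rsum k (fun j => Cabs (E i j) ^ 2)) i)].
- apply (Rsum_ge_term k (fun j => Cabs (E i j) ^ 2) j); [|easy]. intros; apply pow2_ge_0.
- intros; apply Rsum_ge_0. intros; apply pow2_ge_0.
- easy.
Qed.

(** Origin of the constant [1 / k]: each entry of [A - 1] is bounded by the Frobenius norm, so the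
    [k] moduli in a row add up to less than 1, while [Cmod (A i i) >= 1 - Cmod (E i i)]. *)
Lemma frob_diag_dominant k (A : cmat) : (1 <= k)%nat ->
  frob k (fun i j => Csub (A i j) (delta i j)) < 1 / INR k -> diag_dominant k A.
Proof.
intros Hk HA i Hi.
set (E := fun i j => Csub (A i j) (delta i j)) in HA.
assert (Hkpos : 0 < INR k) by (apply lt_0_INR; lia).
assert (H : Rsum k (fun j => Cmod (E i j)) < 1).
{ replace 1 with (INR k * (1 / INR k)) by (field; lra).
  apply Rsum_lt_const; [easy|]. intros j Hj.
  eapply Rle_lt_trans; [|exact HA]. now apply entry_le_frob. }
rewrite (Rsum_split _ _ _ Hi) in H.
assert (Hd : 1 - Cmod (E i i) <= Cmod (A i i)).
{ pose proof (Cmod_sub_lower 1 (- E i i)) as G. rewrite Cmod_opp, Cmod_1 in G.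
  replace (1 - - E i i)%C with (A i i) in G; [exact G|].
  unfold E, delta. rewrite Nat.eqb_refl.
  symmetry. change (1 - - (A i i - 1) = A i i)%C. Cx_ring. }
eapply Rle_lt_trans; [|eapply Rlt_le_trans; [|exact Hd]].
2: { apply Rlt_minus_r. exact H. }
apply Rsum_le. intros j Hj. destruct (Nat.eqb_spec j i) as [|Hne]; [lra|].
right. f_equal. unfold E, delta. destruct (Nat.eqb_spec i j); [congruence|].
symmetry. change (A i j - 0 = A i j)%C. Cx_ring.
Qed.

Import Pilot.Defs.

Theorem theorem3 (k : nat) (A : cmat) (f : cvec -> Cx)
  (hk : (1 <= k)%nat)
  (hA : frob k (fun i j => Csub (A i j) (delta i j)) < 1 / INR k)
  (hf : holomorphic k f) :
  exists v : Cx,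
    torus_integral k
      (fun z => Cdiv (f z) (Cprod k (fun i => mulmv k A z i))) v /\
    Cdiv (f vzero) (det k A)
      = Cmul (Cinv (Cpow (Cmul (RtoC (2 * PI)) Ci) k)) v.
Proof.
pose proof (frob_diag_dominant k A hk hA) as HA.
apply holomorphic_line in hf.
(* The factors [i] of [dz_j = i e^(i th_j) dth_j] are moved into the function, leaving
   [torus_kernel]. *)
set (f' := fun z => Cmult (Complex.Cpow Complex.Ci k) (f z)).
assert (Hf' : line_holomorphic k f').
{ intros a b Ha Hb z. apply C_ex_derive_mult; [apply C_ex_derive_const|now apply hf]. }
destruct (torus_integral_dominant k A f' HA Hf') as (Hdet & H1 & H2).
assert (EG : (fun th => Cmul (Cdiv (f (torus_pt k th))
      (Cprod k (fun i => mulmv k A (torus_pt k th) i)))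
      (Cprod k (fun j => Cmul Ci (Cexpi (th j)))))
    = (fun th => Cmult (f' (torus_pt k th)) (torus_kernel k A th))).
{ apply functional_extensionality. intros th. unfold f', torus_kernel.
  assert (Hnz : forall i, (i < k)%nat -> mulmv k A (torus_pt k th) i <> Complex.RtoC 0).
  { intros i Hi. apply diag_dominant_mulmv_neq_0; [easy|easy| |now apply Cmod_torus_pt].
    intros j Hj. right. now apply Cmod_torus_pt. }
  destruct (Cprod_inv k _ Hnz) as [_ EI].
  assert (E1 : Cprod k (fun i => Cis (th i) / mulmv k A (torus_pt k th) i)%C =
    Cmult (Cprod k (fun j => Cis (th j)))
      (Complex.Cinv (Cprod k (fun i => mulmv k A (torus_pt k th) i)))).
  { exact (eq_trans (Cprod_mul k (fun i => Cis (th i))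
      (fun i => Complex.Cinv (mulmv k A (torus_pt k th) i))) (f_equal (Cmult _) EI)). }
  assert (E2 : Cprod k (fun j => Cmul Ci (Cexpi (th j))) =
    Cmult (Complex.Cpow Complex.Ci k) (Cprod k (fun j => Cis (th j)))).
  { rewrite <- Cprod_const. exact (Cprod_mul k (fun _ => Ci) (fun j => Cexpi (th j))). }
  rewrite E1, E2.
  change (f (torus_pt k th) * / Cprod k (fun i => mulmv k A (torus_pt k th) i)
    * (Complex.Cpow Complex.Ci k * Cprod k (fun j => Cis (th j))) =
    Complex.Cpow Complex.Ci k * f (torus_pt k th) * (Cprod k (fun j => Cis (th j)) *
     / Cprod k (fun i => mulmv k A (torus_pt k th) i)))%C.
  Cx_ring. }
eexists. split.
- split; [exact (eq_ind_r (fun G => iter_int k (fun th => fst (G th)) _) H1 EG)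
    |exact (eq_ind_r (fun G => iter_int k (fun th => snd (G th)) _) H2 EG)].
- assert (EP : forall z, Cpow z k = Complex.Cpow z k).
  { intros z. clear. induction k as [|k IH]; [reflexivity|].
    change (Cmult z (Cpow z k) = Cmult z (Complex.Cpow z k)). now rewrite IH. }
  rewrite EP.
  assert (P2 : Complex.RtoC (2 * PI) <> Complex.RtoC 0).
  { pose proof PI_RGT_0. intros E. injection E. lra. }
  assert (Ci0 : Complex.Ci <> Complex.RtoC 0) by (intros [=]; lra).
  change (f vzero / det k A = / (Complex.Cpow (Complex.RtoC (2 * PI) * Complex.Ci) k) *
    (Complex.Cpow (Complex.RtoC (2 * PI)) k * (Complex.Cpow Complex.Ci k * f vzero / det k A)))%C.
  rewrite Cpow_mult_l. field. repeat split; try apply Cpow_nz; easy.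
Qed.
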